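(* Let $p\in[0,1]$ be fixed and let $G'_{n,m}(p)$ be a random $m$-partite graph on $[n]$ with parts of sizes $n\nu_1(n),\dots,n\nu_m(n)$, $m=m(n)$, such that $$\lim_{n\to\infty}\max\{\nu_1(n),\dots,\nu_m(n)\}=0.$$ Then almost every random graph $G'_{n,m}(p)$ satisfies $$\mathscr{E}(G'_{n,m}(p))=n^{3/2}\left(\frac{8}{3\pi}\sqrt{p(1-p)}+o(1)\right).$$
   Context: For a simple graph $G$ with adjacency matrix eigenvalues $\lambda_1,\dots,\lambda_n$ (with multiplicity), the energy is $\mathscr{E}(G)=\sum_{i=1}^n|\lambda_i|$. For each $n$, $[n]=\{1,\dots,n\}$ is partitioned into nonempty parts $V_1,\dots,V_m$, $m=m(n)\ge2$, with $|V_i|=n\nu_i(n)$; the random $m$-partite graph is obtained by including each edge of the complete $m$-partite graph with parts $V_1,\dots,V_m$ independently with probability $p$ (no edges inside parts). ''Almost every'' graph has a property if its probability tends to $1$ as $n\to\infty$; the asymptotic equality with $o(1)$ means that for each $\varepsilon>0$, with probability tending to $1$, the error term is at most $\varepsilon$ in absolute value. *)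

(* Defs.v *)
From HB Require Import structures.
From mathcomp Require Import all_boot all_order all_algebra.
From mathcomp Require Import all_classical all_reals all_analysis.
From mathcomp Require Import -(notations) complex.
From mathcomp Require polyrcf spectral.

Set Implicit Arguments.
Unset Strict Implicit.
Unset Printing Implicit Defensive.

Import Order.TTheory GRing.Theory Num.Theory.
Import numFieldNormedType.Exports.

Local Open Scope ring_scope.

(* A simple graph on the vertex set 'I_n, given by its set of edges; the       *)
(* edges are meant to be two-element sets.                                     *)
Definition graph (n : nat) := {set {set 'I_n}}.

Definition adjmx (R : realType) (n : nat) (G : graph n) : 'M[R]_n :=
  \matrix_(i, j) ((i != j) && ([set i; j]%SET \in G))%:R.

(* [rootsR] lists the distinct real roots, so each one is repeated according   *)
(* to its multiplicity. For a symmetric real matrix this is the full spectrum, *)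
(* see [char_poly_sym].                                                        *)
Definition eigenvalues (R : realType) (n : nat) (A : 'M[R]_n) : seq R :=
  flatten [seq nseq (mup x (char_poly A)) x | x <- polyrcf.rootsR (char_poly A)].

Lemma char_poly_sym (R : realType) (n : nat) (A : 'M[R]_n) :
  A^T = A -> char_poly A = \prod_(x <- eigenvalues A) ('X - x%:P).
Proof.
move=> symA; pose C : numClosedFieldType := complex.complex R.
pose f : {rmorphism R -> C} := @complex.real_complex_def R (Phant R).
have [s Ds] : exists s : seq R, char_poly A = \prod_(x <- s) ('X - x%:P).
  pose B : 'M[C]_n := map_mx f A.
  have realB : B \is a mxOver Num.real.
    by apply/mxOverP => i j; rewrite mxE complex.complex_real.
  have hermB : B \is sesquilinear.hermitianmx n false Num.conj.
    apply: spectral.realsym_hermsym => //; apply/sesquilinear.is_hermitianmxP.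
    by rewrite expr0 scale1r map_mx_id // /B map_trmx symA.
  have /spectral.orthomx_spectralP DB := spectral.hermitian_normalmx hermB.
  have /mxOverP realD := spectral.hermitian_spectral_diag_real hermB.
  set P := spectral.spectralmx B in DB.
  set d := spectral.spectral_diag B in DB realD.
  have PU : P \in unitmx := spectral.spectral_unit B.
  exists [seq complex.Re (d 0 i) | i <- enum 'I_n].
  apply: (map_poly_inj f).
  rewrite map_char_poly -/B.
  have -> : char_poly B = char_poly (diag_mx d).
    rewrite DB /char_poly /char_poly_mx.
    have -> : 'X%:M - map_mx polyC (invmx P *m diag_mx d *m P) =
        map_mx polyC (invmx P) *m ('X%:M - map_mx polyC (diag_mx d))
          *m map_mx polyC P.
      rewrite mulmxBr mulmxBl !map_mxM /=; congr (_ - _).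
      by rewrite scalar_mxC -mulmxA -map_mxM mulVmx // map_mx1 mulmx1.
    rewrite !det_mulmx mulrAC -det_mulmx -map_mxM mulVmx //.
    by rewrite map_mx1 det1 mul1r.
  rewrite char_poly_trig ?diag_mx_is_trig // rmorph_prod /= big_map big_enum /=.
  apply: eq_bigr => i _; rewrite map_polyXsubC /= mxE eqxx mulr1n.
  by rewrite complex.RRe_real.
suff /(perm_big _) -> : perm_eq (eigenvalues A) s by [].
have nz : char_poly A != 0 by rewrite monic_neq0 // char_poly_monic.
apply/allP => x _ /=; rewrite -(mu_prod_XsubC x s) -Ds /eigenvalues.
rewrite count_flatten -map_comp sumnE big_map /=.
under eq_bigr => y _ do rewrite count_nseq.
have [rx|rx] := boolP (x \in polyrcf.rootsR (char_poly A)).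
  rewrite (bigD1_seq x) ?polyrcf.uniq_roots //= eqxx mul1n big1 ?addn0 // => y.
  by move=> /negPf ->.
rewrite mupNroot; last first.
  by apply: contra rx => rx; rewrite -(polyrcf.roots_on_rootsR nz) rx in_itv.
rewrite big1_seq // => y /=; case: eqVneq => [->|//].
by rewrite (negPf rx).
Qed.

Definition energy (R : realType) (n : nat) (G : graph n) : R :=
  \sum_(x <- eigenvalues (adjmx R G)) `|x|.

Definition vertex_partition (n m : nat) (V : 'I_m -> {set 'I_n}) : Prop :=
  [/\ forall i, (0 < #|V i|)%N,
      forall i j, i != j -> [disjoint V i & V j]
    & forall x, exists i, x \in V i].

Definition complete_multipartite (n m : nat) (V : 'I_m -> {set 'I_n}) :
    graph n :=
  [set e : {set 'I_n} | (#|e| == 2) && [forall i, ~~ (e \subset V i)]]%SET.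

(* The law of the random m-partite graph: the edges of the complete m-partite  *)
(* graph are present independently, each with probability [p].                 *)
Definition multipartite_pr (R : realType) (p : R) (n m : nat)
    (V : 'I_m -> {set 'I_n}) (A : set (graph n)) : R :=
  \sum_(G in powerset (complete_multipartite V) | G \in A)
    \prod_(e in complete_multipartite V) (if e \in G then p else 1 - p).

Lemma multipartite_prT (R : realType) (p : R) (n m : nat)
    (V : 'I_m -> {set 'I_n}) : multipartite_pr p V setT = 1.
Proof.
rewrite /multipartite_pr; set K := complete_multipartite V.
pose F e : R := if e \in K then p else 0.
pose H e : R := if e \in K then 1 - p else 1.
have := bigA_distr 1 +%R F H; rewrite big1 => [E|e _]; last first.
  by rewrite /F /H; case: ifP => _ /=; rewrite ?add0r // addrC subrK.
rewrite [RHS]E.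
rewrite [RHS](bigID (fun G : graph n => G \in powerset K)) /=.
rewrite [X in _ = _ + X]big1 ?addr0 => [|G]; last first.
  rewrite powersetE => /subsetPn[e eG eK].
  by rewrite (bigD1 e) //= eG /F (negPf eK) mul0r.
apply: eq_big => [G|G /andP[]]; first by rewrite in_setT andbT.
rewrite powersetE => /fintype.subsetP GK _.
rewrite [RHS](bigID (mem K)) /= [X in _ = _ * X]big1 ?mulr1 => [|e eK].
  by apply: eq_bigr => e eK; rewrite /F /H eK.
rewrite /H (negPf eK); by case: ifP => // /GK; rewrite (negPf eK).
Qed.

(* Main.v *)
(* Writing [|x| = 2 / pi * \int_0^oo x^2 / (x^2 + t^2) dt] reduces the energy to the
   normalized traces [tr (Y^2 + t^2)^-1], [Y = adj / sqrt n], at finitely many points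
   [t] of a fine grid. These traces are compared with those of the centered matrix
   [X = (adj G - p adj K) / sqrt n]: the difference [p adj K / sqrt n] has trace norm
   at most [2 p sqrt n] although its rank may be large.

   Let [A + i B] be the resolvent [(X - i t)^-1], and let [a], [b] be the normalized
   traces of [A], [B]. Integration by parts in each edge variable gives
     [1 - t E b = s E (b^2 - a^2) + o(1)] and [t E a = - 2 s E (a b) + o(1)],
   where [s = p (1 - p)]; the pairs inside the parts are negligible because they make
   up a proportion at most [max nu] of all pairs. By the Efron-Stein inequality the
   variances of [a] and [b] are [O(1 / n)], so [E b] approaches the positive root [h]
   of [s h^2 + t h = 1], the value for the semicircle law. *)

Require Import Defs.
From mathcomp Require Import all_boot all_order all_algebra.
From mathcomp Require Import all_classical all_reals all_analysis.
From mathcomp Require Import ring lra.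
From mathcomp Require Import -(notations) complex.
From mathcomp Require spectral.
Set Implicit Arguments.
Unset Strict Implicit.
Unset Printing Implicit Defensive.

Import Order.TTheory GRing.Theory Num.Theory.
Import numFieldNormedType.Exports.

Local Open Scope classical_set_scope.
Local Open Scope ring_scope.

(** * Resolvents of symmetric matrices *)

Section Resolvent.
Variables (R : realFieldType) (n : nat).
Implicit Types (X D : 'M[R]_n) (u v w : 'rV[R]_n) (t : R).

(** The graph is not a Wigner matrix: pairs inside a part are absent, and the number of parts may
    grow, so [p adj K] cannot be discarded as a low-rank perturbation. It is handled through
    [adj K = J - sum_k 1_k 1_k^T], where [J] is the all-ones matrix and the vectors have squared
    lengths of total [2 n], and through a resolvent bound linear in these squared lengths. The edges
    are Bernoulli, yet integration by parts is exact once the derivative is replaced by the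
    difference between edge present and edge absent; the resolvent identity evaluates that
    difference exactly, so no Taylor remainder arises. Large eigenvalues are controlled by the
    second moment alone: cutting the integral for [|x|] at [T] costs [x^2 / T], and
    [tr adj^2 <= n^2]. The grid is chosen independently of [n], so constants may blow up as [t]
    tends to [0]. The factor [8 / (3 pi)] is [2 / pi] times [4 / 3], where [4/3 sqrt s] is the
    integral of [1 - t h(t)] over [t > 0]. *)

Definition dotv u v : R := (u *m v^T) 0 0.

Lemma dotvE u v : dotv u v = \sum_i u 0 i * v 0 i.
Proof. by rewrite /dotv mxE; apply: eq_bigr => i _; rewrite mxE. Qed.

Lemma dotvC u v : dotv u v = dotv v u.
Proof. by rewrite !dotvE; apply: eq_bigr => i _; rewrite mulrC. Qed.

Lemma dotv_ge0 u : 0 <= dotv u u.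
Proof. by rewrite dotvE; apply: sumr_ge0 => i _; rewrite -expr2 sqr_ge0. Qed.

Lemma dotv_eq0 u : dotv u u = 0 -> u = 0.
Proof.
rewrite dotvE => /psumr_eq0P H; apply/rowP => i; rewrite mxE.
have /eqP := H (fun i _ => ltac:(by rewrite -expr2 sqr_ge0)) i isT.
by rewrite -expr2 expf_eq0 => /eqP.
Qed.

Lemma dotvDl u v w : dotv (u + v) w = dotv u w + dotv v w.
Proof. by rewrite /dotv mulmxDl mxE. Qed.

Lemma dotvDr u v w : dotv u (v + w) = dotv u v + dotv u w.
Proof. by rewrite dotvC dotvDl !(dotvC u). Qed.

Lemma dotvZl (c : R) u v : dotv (c *: u) v = c * dotv u v.
Proof. by rewrite /dotv -scalemxAl mxE. Qed.

Lemma dotvZr (c : R) u v : dotv u (c *: v) = c * dotv u v.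
Proof. by rewrite dotvC dotvZl dotvC. Qed.

Lemma dotvMl u v X : dotv (u *m X) v = dotv u (v *m X^T).
Proof. by rewrite /dotv trmx_mul trmxK mulmxA. Qed.

(** Squared lengths instead of lengths avoid square roots, and such bounds add up along sums of
    rank-one terms. *)
Lemma normr_dotv_le u v : `|dotv u v| <= (dotv u u + dotv v v) / 2%:R.
Proof.
have H (w : 'rV[R]_n) : 0 <= dotv u u + 2 * dotv u w + dotv w w.
  have := dotv_ge0 (u + w); rewrite dotvDl !dotvDr (dotvC w u); lra.
have := H v; have := H ((-1) *: v); rewrite !dotvZl !dotvZr => H1 H2.
by rewrite ler_norml; apply/andP; split; lra.
Qed.

(** This is [(X - i t) (X + i t)]; its inverse gives the resolvent while all matrices stay real. *)
Definition sqshift X t : 'M[R]_n := X *m X + (t ^+ 2)%:M.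

(* For symmetric [X] these are the real and the imaginary part of the        *)
(* resolvent [(X - i t)^-1].                                                 *)
Definition resolvent_re X t : 'M[R]_n := X *m invmx (sqshift X t).
Definition resolvent_im X t : 'M[R]_n := t *: invmx (sqshift X t).

Section Symmetric.
Variables (X : 'M[R]_n) (t : R).
Hypotheses (symX : X^T = X) (t_gt0 : 0 < t).

Let Q := sqshift X t.
Let A := resolvent_re X t.
Let B := resolvent_im X t.

Lemma dotv_sqshift u :
  dotv (u *m Q) u = dotv (u *m X) (u *m X) + t ^+ 2 * dotv u u.
Proof.
by rewrite mulmxDr dotvDl mulmxA dotvMl symX mul_mx_scalar dotvZl.
Qed.

Lemma sqshift_unit : Q \in unitmx.
Proof.
rewrite -row_free_unit -kermx_eq0; apply/eqP/row_matrixP => i.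
rewrite row0; set u := row i _.
have uQ : u *m Q = 0 by apply: sub_kermxP; apply: row_sub.
apply: dotv_eq0; have := dotv_sqshift u.
rewrite uQ /dotv mul0mx mxE -!/(dotv _ _) => H.
have := dotv_ge0 (u *m X); have := dotv_ge0 u => H1 H2.
have t2 : 0 < t ^+ 2 by rewrite exprn_gt0.
apply/eqP; rewrite eq_le H1 andbT -(pmulr_rle0 _ t2); lra.
Qed.

Lemma tr_sqshift : Q^T = Q.
Proof. by rewrite linearD /= trmx_mul symX tr_scalar_mx. Qed.

Lemma tr_invmx_sqshift : (invmx Q)^T = invmx Q.
Proof. by rewrite trmx_inv tr_sqshift. Qed.

Lemma comm_sqshift : X *m Q = Q *m X.
Proof. by rewrite mulmxDr mulmxDl mulmxA scalar_mxC. Qed.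

Lemma comm_invmx_sqshift : X *m invmx Q = invmx Q *m X.
Proof.
apply: (canRL (mulKmx sqshift_unit)).
by rewrite !mulmxA -comm_sqshift mulmxK // sqshift_unit.
Qed.

Lemma tr_resolvent_re : A^T = A.
Proof. by rewrite trmx_mul tr_invmx_sqshift symX -comm_invmx_sqshift. Qed.

Lemma tr_resolvent_im : B^T = B.
Proof. by rewrite linearZ /= tr_invmx_sqshift. Qed.

(** Real part of [(A + i B) (X - i t) = 1]; [resolvent_imM] is the imaginary part, and the two
    lemmas after it are the same for the product in the other order. *)
Lemma resolvent_reM : A *m X + t *: B = 1%:M.
Proof.
rewrite /A /B /resolvent_re /resolvent_im comm_invmx_sqshift scalerA -expr2.
by rewrite -mul_mx_scalar -mulmxA -mulmxDr mulVmx // sqshift_unit.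
Qed.

Lemma resolvent_imM : B *m X = t *: A.
Proof. by rewrite -scalemxAl -comm_invmx_sqshift. Qed.

Lemma mul_resolvent_re : X *m A + t *: B = 1%:M.
Proof.
have := congr1 trmx resolvent_reM.
by rewrite linearD linearZ /= trmx_mul tr_resolvent_re tr_resolvent_im symX trmx1.
Qed.

Lemma mul_resolvent_im : X *m B = t *: A.
Proof.
have := congr1 trmx resolvent_imM.
by rewrite linearZ /= trmx_mul tr_resolvent_re tr_resolvent_im symX.
Qed.

(** [A^2 + B^2 = Q^-1], so with [w = u Q^-1] the left side is [dotv u w], and [Q] dominates [t^2].
    Treating [A] and [B] jointly spares a factor 2 when the resolvent identity contributes two
    products. *)
Lemma resolvent_norm u :
  dotv (u *m A) (u *m A) + dotv (u *m B) (u *m B) <= dotv u u / t ^+ 2.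
Proof.
have tn0 : t != 0 by rewrite gt_eqF.
pose w := u *m invmx Q.
have uE : u = w *m Q by rewrite mulmxKV // sqshift_unit.
have wA : u *m A = w *m X by rewrite /A /resolvent_re comm_invmx_sqshift mulmxA.
have wB : u *m B = t *: w by rewrite /B /resolvent_im -scalemxAr.
rewrite wA wB dotvZl dotvZr mulrA -expr2 -dotv_sqshift -uE.
have := dotv_ge0 (t *: w + (- t^-1) *: u).
rewrite dotvDl !dotvDr !dotvZl !dotvZr.
have -> : t * (- t^-1 * dotv w u) = - dotv u w by rewrite dotvC; field.
have -> : - t^-1 * (t * dotv u w) = - dotv u w by field.
have -> : - t^-1 * (- t^-1 * dotv u u) = dotv u u / t ^+ 2 by field.
have -> : t * (t * dotv w w) = dotv u w - dotv (w *m X) (w *m X).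
  by rewrite {1}uE dotv_sqshift; ring.
have := dotv_ge0 (w *m X); lra.
Qed.

End Symmetric.

(** * Comparison of two resolvents *)

Section Perturbation.
Variables (X X' : 'M[R]_n) (t : R).
Hypotheses (symX : X^T = X) (symX' : X'^T = X') (t_gt0 : 0 < t).

Let A := resolvent_re X t.
Let B := resolvent_im X t.
Let A' := resolvent_re X' t.
Let B' := resolvent_im X' t.

(* The real and the imaginary part of the resolvent identity                 *)
(* [G' - G = G' (X - X') G] for [G = A + i B].                               *)
Lemma resolvent_re_sub :
  A' - A = B' *m (X' - X) *m B - A' *m (X' - X) *m A.
Proof.
have eA : A' = A' *m X *m A + t *: (A' *m B).
  by rewrite -mulmxA scalemxAr -mulmxDr mul_resolvent_re // mulmx1.
have eA' : A = A' *m X' *m A + t *: (B' *m A).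
  by rewrite scalemxAl -mulmxDl resolvent_reM // mul1mx.
have e0 : B' *m X *m B = t *: (B' *m A).
  by rewrite -mulmxA scalemxAr mul_resolvent_im.
have e0' : B' *m X' *m B = t *: (A' *m B).
  by rewrite resolvent_imM // scalemxAl.
rewrite [LHS](congr2 (fun P Q => P - Q) eA eA') !mulmxBr !mulmxBl e0 e0'.
by apply/matrixP=> i j; rewrite !mxE; ring.
Qed.

Lemma resolvent_im_sub :
  B' - B = - (B' *m (X' - X) *m A + A' *m (X' - X) *m B).
Proof.
have eB : B' = B' *m X *m A + t *: (B' *m B).
  by rewrite -mulmxA scalemxAr -mulmxDr mul_resolvent_re // mulmx1.
have eB' : B = A' *m X' *m B + t *: (B' *m B).
  by rewrite scalemxAl -mulmxDl resolvent_reM // mul1mx.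
have e0 : A' *m X *m B = t *: (A' *m A).
  by rewrite -mulmxA scalemxAr mul_resolvent_im.
have e0' : B' *m X' *m A = t *: (A' *m A).
  by rewrite resolvent_imM // scalemxAl.
rewrite [LHS](congr2 (fun P Q => P - Q) eB eB') !mulmxBr !mulmxBl e0 e0'.
by apply/matrixP=> i j; rewrite !mxE; ring.
Qed.

Let trace_rank1 P Q u v : P^T = P -> Q^T = Q ->
  \tr (P *m (u^T *m v) *m Q) = dotv (v *m Q) (u *m P).
Proof.
move=> symP symQ; rewrite mulmxA -mulmxA mxtrace_mulC /mxtrace big_ord1.
by rewrite /dotv trmx_mul symP.
Qed.

(** The trace against [u^T v] is an inner product, hence at most a mean of squared lengths. The
    bound sees the lengths of the vectors and not their number, so it serves both for a single edge
    and for [p adj K]. *)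
Lemma trace_resolvent_sub (I : finType) (c : I -> R) (u v : I -> 'rV[R]_n) :
  X' - X = \sum_k c k *: ((u k)^T *m v k) ->
  `|\tr A' - \tr A| <=
     \sum_k `|c k| * (dotv (u k) (u k) + dotv (v k) (v k)) / (2 * t ^+ 2) /\
  `|\tr B' - \tr B| <=
     \sum_k `|c k| * (dotv (u k) (u k) + dotv (v k) (v k)) / (2 * t ^+ 2).
Proof.
have [sA sB] := (tr_resolvent_re symX t_gt0, tr_resolvent_im t symX).
have [sA' sB'] := (tr_resolvent_re symX' t_gt0, tr_resolvent_im t symX').
move=> DE; have trD P Q : P^T = P -> Q^T = Q ->
    \tr (P *m (X' - X) *m Q) = \sum_k c k * dotv (v k *m Q) (u k *m P).
  move=> sP sQ; rewrite DE mulmx_sumr mulmx_suml raddf_sum /=.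
  apply: eq_bigr => k _.
  by rewrite -scalemxAr -scalemxAl linearZ /= trace_rank1.
have bound k (x y : R) : `|x| + `|y| <=
      (dotv (v k *m A) (v k *m A) + dotv (v k *m B) (v k *m B)) / 2 +
      (dotv (u k *m A') (u k *m A') + dotv (u k *m B') (u k *m B')) / 2 ->
    `|x| + `|y| <= (dotv (u k) (u k) + dotv (v k) (v k)) / (2 * t ^+ 2).
  move=> /le_trans; apply; rewrite invfM mulrA [_ / 2 / _]mulrAC.
  have := resolvent_norm symX t_gt0 (v k).
  have := resolvent_norm symX' t_gt0 (u k); rewrite -/A -/B -/A' -/B'; lra.
split.
- rewrite -linearB /= resolvent_re_sub linearB /= !trD // -sumrB.
  apply: le_trans (ler_norm_sum _ _ _) _; apply: ler_sum => k _.
  rewrite -mulrBr normrM -mulrA ler_wpM2l // (le_trans (ler_normB _ _)) //.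
  apply: bound.
  have := normr_dotv_le (v k *m A) (u k *m A').
  have := normr_dotv_le (v k *m B) (u k *m B'); lra.
- rewrite -linearB /= resolvent_im_sub linearN linearD /= !trD // -big_split /=.
  rewrite normrN; apply: le_trans (ler_norm_sum _ _ _) _; apply: ler_sum => k _.
  rewrite -mulrDr normrM -mulrA ler_wpM2l // (le_trans (ler_normD _ _)) //.
  apply: bound.
  have := normr_dotv_le (v k *m B) (u k *m A').
  have := normr_dotv_le (v k *m A) (u k *m B'); lra.
Qed.

End Perturbation.
End Resolvent.

(** * Random subsets of a finite set *)

Section RandomSubset.
Variables (R : realFieldType) (p : R) (T : finType).
Implicit Types (K G : {set T}) (f g : {set T} -> R) (e : T).

Definition subset_weight K G : R := \prod_(e in K) (if e \in G then p else 1 - p).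

Definition expect K f : R := \sum_(G in powerset K) subset_weight K G * f G.

Lemma subset_weight0 G : subset_weight finset.set0 G = 1.
Proof. by rewrite /subset_weight big_set0. Qed.

Lemma subset_weightU1 e K G : e \notin K ->
  subset_weight (e |: K) G = (if e \in G then p else 1 - p) * subset_weight K G.
Proof. by move=> eK; rewrite /subset_weight big_setU1. Qed.

Lemma eq_expect K f g : (forall G, G \subset K -> f G = g G) ->
  expect K f = expect K g.
Proof. by move=> fg; apply: eq_bigr => G; rewrite powersetE => /fg ->. Qed.

Lemma expect0 f : expect finset.set0 f = f finset.set0.
Proof. by rewrite /expect powerset0 big_set1 subset_weight0 mul1r. Qed.

(** Conditioning on the presence of [e]: the step behind the inductions on [K] and the integration
    by parts. *)
Lemma expectU1 e K f : e \notin K ->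
  expect (e |: K) f =
    p * expect K (fun G => f (e |: G)) + (1 - p) * expect K f.
Proof.
move=> eK; rewrite /expect (bigID (fun G : {set T} => e \in G)) /=.
have eS G : G \subset K -> e \notin G.
  by move=> GK; apply: contra eK; apply: (fintype.subsetP GK).
congr (_ + _).
- rewrite (reindex_onto (fun G => e |: G) (fun G => G :\ e)) /=; last first.
    by move=> G /andP[_ eG]; rewrite finset.setD1K.
  rewrite big_distrr /=; apply: eq_big => [G|G].
    rewrite !powersetE setU11 andbT; apply/andP/idP => [[]|GK].
      move=> /fintype.subsetP H /eqP H2; apply/fintype.subsetP => x xG.
      have /H : x \in e |: G by rewrite in_setU1 xG orbT.
      rewrite in_setU1 => /orP[/eqP xe|//].
      by move: xG; rewrite -H2 xe setD11.
    by split; [exact: finset.setUS | rewrite setU1K // eS].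
  move=> /andP[/andP[_ _] /eqP H2]; rewrite subset_weightU1 // setU11.
  rewrite -mulrA; congr (_ * (_ * _)); apply: eq_bigr => x xK.
  by rewrite in_setU1 (_ : (x == e) = false) //; apply: contraNF eK => /eqP <-.
- rewrite big_distrr /=; apply: eq_big => [G|G].
    rewrite !powersetE; apply/andP/idP => [[GK eG]|GK].
      apply/fintype.subsetP => x xG; have := fintype.subsetP GK x xG.
      by rewrite in_setU1 => /orP[/eqP xe|//]; move: eG; rewrite -xe xG.
    by split; [apply: fintype.subset_trans GK (finset.subsetUr _ _) | exact: eS].
  by move=> /andP[_ eG]; rewrite subset_weightU1 // (negPf eG) -mulrA.
Qed.

Lemma expectD K f g : expect K (fun G => f G + g G) = expect K f + expect K g.
Proof.
by rewrite /expect -big_split /=; apply: eq_bigr => G _; rewrite mulrDr.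
Qed.

Lemma expectZ K (c : R) f : expect K (fun G => c * f G) = c * expect K f.
Proof. by rewrite /expect big_distrr /=; apply: eq_bigr => G _; rewrite mulrCA. Qed.

Lemma expectN K f : expect K (fun G => - f G) = - expect K f.
Proof.
by rewrite -mulN1r -expectZ; apply: eq_expect => G _; rewrite mulN1r.
Qed.

Lemma expectB K f g : expect K (fun G => f G - g G) = expect K f - expect K g.
Proof. by rewrite expectD expectN. Qed.

Lemma expect_sum (I : Type) (r : seq I) (P : pred I) (F : I -> {set T} -> R) K :
  expect K (fun G => \sum_(i <- r | P i) F i G) =
  \sum_(i <- r | P i) expect K (F i).
Proof.
rewrite /expect exchange_big /=; apply: eq_bigr => G _.
by rewrite big_distrr.
Qed.

Lemma expect_cst K (c : R) : expect K (fun=> c) = c.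
Proof.
move: {2}#|K| (erefl #|K|) => n; elim: n K => [|n IH] K.
  by move/eqP; rewrite cards_eq0 => /eqP ->; rewrite expect0.
move=> cK; have /finset.set0Pn[e eK] : K != finset.set0 by rewrite -card_gt0 cK.
rewrite -(finset.setD1K eK) expectU1 ?setD11 // !IH; first by ring.
by move: cK; rewrite (cardsD1 e) eK => -[].
Qed.

Hypothesis p01 : 0 <= p <= 1.

Lemma subset_weight_ge0 K G : 0 <= subset_weight K G.
Proof. by apply: prodr_ge0 => e _; case: ifP => _; move: p01; lra. Qed.

Lemma ler_expect K f g : (forall G, G \subset K -> f G <= g G) ->
  expect K f <= expect K g.
Proof.
move=> fg; apply: ler_sum => G; rewrite powersetE => GK.
by rewrite ler_wpM2l ?subset_weight_ge0 // fg.
Qed.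

Lemma ler_norm_expect K f : `|expect K f| <= expect K (fun G => `|f G|).
Proof.
apply: le_trans (ler_norm_sum _ _ _) _; apply: ler_sum => G _.
by rewrite normrM ger0_norm // subset_weight_ge0.
Qed.

Lemma expect_norm_le K f (c : R) : (forall G, G \subset K -> `|f G| <= c) ->
  `|expect K f| <= c.
Proof.
move=> fc; apply: le_trans (ler_norm_expect _ _) _.
by rewrite -[leRHS](expect_cst K); apply: ler_expect.
Qed.

(** Given all other elements, the centered indicator is [1 - p] with probability [p] and [- p] with
    probability [1 - p], so only the difference of the two values of [f] survives. *)
Lemma expect_integration_by_parts e K f : e \in K ->
  expect K (fun G => ((e \in G)%:R - p) * f G) =
  p * (1 - p) * expect K (fun G => f (e |: G) - f (G :\ e)).
Proof.
move=> eK; rewrite -(finset.setD1K eK); set K' := K :\ e.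
have eK' : e \notin K' by rewrite setD11.
have eS G : G \subset K' -> e \notin G.
  by move=> GK; apply: contra eK'; apply: (fintype.subsetP GK).
rewrite !expectU1 //.
under eq_expect => G GK do rewrite setU11.
rewrite [X in _ + _ * X](@eq_expect _ _ (fun G => (- p) * f G)); last first.
  by move=> G /eS /negPf ->; rewrite sub0r.
under [X in _ * (_ * X + _)]eq_expect => G /eS eG.
  rewrite finset.setUA finset.setUid setU1K //; over.
rewrite [X in _ * (_ + _ * X)](@eq_expect _ _ (fun G => f (e |: G) - f G)).
  rewrite !expectZ !expectB /=; ring.
move=> G /eS eG; congr (_ - f _).
by apply/finset.setDidPl; rewrite disjoint_sym disjoints1.
Qed.

Definition variance K f := expect K (fun G => (f G - expect K f) ^+ 2).

Lemma varianceE K f : variance K f = expect K (fun G => f G ^+ 2) - expect K f ^+ 2.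
Proof.
rewrite /variance; set a := expect K f.
rewrite (@eq_expect _ _ (fun G => (f G ^+ 2 + (- (2 * a)) * f G) + a ^+ 2)).
  by rewrite !expectD expectZ expect_cst -/a; ring.
by move=> G _; ring.
Qed.

Lemma sqr_expect_le K f : expect K f ^+ 2 <= expect K (fun G => f G ^+ 2).
Proof.
rewrite -subr_ge0 -varianceE -[leLHS](expect_cst K).
by apply: ler_expect => G _; exact: sqr_ge0.
Qed.

(** Induction by the law of total variance: an element [e] splits off the averaged conditional
    variances and [p (1 - p)] times the squared gap of the conditional means. The hypothesis ranges
    over every [G] so that the function [f (e |: G)] inherits it. *)
Lemma efron_stein K f (c : R) : 0 <= c ->
  (forall e G, e \in K -> `|f (e |: G) - f G| <= c) ->
  variance K f <= #|K|%:R * c ^+ 2.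
Proof.
move=> c0; move: {2}#|K| (erefl #|K|) => n; elim: n K f => [|n IH] K f.
  move=> /[dup] cK /eqP; rewrite cards_eq0 => /eqP -> _.
  by rewrite varianceE !expect0 subrr cards0 mul0r.
move=> cK; have /finset.set0Pn[e eK] : K != finset.set0 by rewrite -card_gt0 cK.
have cK' : #|K :\ e| = n by move: cK; rewrite (cardsD1 e) eK => -[].
move: cK' => /[dup] cK'; rewrite cK -(finset.setD1K eK); set K' := K :\ e => cK'' H.
have eK' : e \notin K' by rewrite setD11.
have H' x G : x \in K' -> `|f (x |: G) - f G| <= c.
  by move=> xK; apply: H; rewrite in_setU1 xK orbT.
have V0 := IH K' f cK' H'.
have V1 : variance K' (fun G => f (e |: G)) <= #|K'|%:R * c ^+ 2.
  by apply: IH => // x G xK; rewrite finset.setUCA; apply: H'.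
have D : `|expect K' (fun G => f (e |: G)) - expect K' f| <= c.
  by rewrite -expectB; apply: expect_norm_le => G _; apply: H; rewrite setU11.
move: V0 V1 D; rewrite !varianceE !expectU1 //.
set a1 := expect _ _; set b1 := expect _ _; set a2 := expect _ _; set b2 := expect _ _.
rewrite cK' -natr1; set N := n%:R * _ => V0 V1 D.
have D2 : (b2 - b1) ^+ 2 <= c ^+ 2 by rewrite -real_normK ?num_real // lerXn2r ?nnegrE.
have c2 : 0 <= c ^+ 2 by apply: sqr_ge0.
have p2 : 0 <= p * (1 - p) by apply: mulr_ge0; move: p01; lra.
have q2 : p * (1 - p) <= 1 by move: p01 (sqr_ge0 p); rewrite expr2; nra.
have -> : p * a2 + (1 - p) * a1 - (p * b2 + (1 - p) * b1) ^+ 2 =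
  p * (a2 - b2 ^+ 2) + (1 - p) * (a1 - b1 ^+ 2) + p * (1 - p) * (b2 - b1) ^+ 2.
  by ring.
rewrite [leRHS]mulrDl mul1r -/N; apply: lerD.
  have -> : N = p * N + (1 - p) * N by ring.
  by apply: lerD; apply: ler_wpM2l => //; move: p01; lra.
apply: le_trans (ler_wpM2l p2 D2) _.
by rewrite -[leRHS]mul1r ler_wpM2r.
Qed.

(** From [|x y| <= (x^2 + y^2) / 2] for centered [x], [y]. It allows [E (a b)], [E (a^2)] and
    [E (b^2)] to be replaced by products of expectations. *)
Lemma norm_covariance_le K f g :
  `|expect K (fun G => f G * g G) - expect K f * expect K g| <=
    (variance K f + variance K g) / 2%:R.
Proof.
set a := expect K f; set b := expect K g.
have -> : expect K (fun G => f G * g G) - a * b =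
          expect K (fun G => (f G - a) * (g G - b)).
  rewrite [RHS](@eq_expect _ _ (fun G => (f G * g G + (- b) * f G + (- a) * g G) + a * b)).
    by rewrite !expectD !expectZ expect_cst -/a -/b; ring.
  by move=> G _; ring.
apply: le_trans (ler_norm_expect _ _) _.
rewrite mulrC /variance -/a -/b -expectD -expectZ; apply: ler_expect => G _.
set x := _ - a; set y := _ - b.
rewrite normrM -(real_normK (num_real x)) -(real_normK (num_real y)).
have := sqr_ge0 (`|x| - `|y|); rewrite sqrrB; nra.
Qed.

Lemma markov_expect K (A : {set T} -> bool) f (d : R) : 0 < d ->
  (forall G, G \subset K -> 0 <= f G) ->
  (forall G, G \subset K -> ~~ A G -> d <= f G) ->
  1 - expect K f / d <= expect K (fun G => (A G)%:R).
Proof.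
move=> d0 f0 fd; rewrite -[X in X - _](expect_cst K) mulrC -expectZ -expectB.
apply: ler_expect => G GK; have := f0 G GK; have := fd G GK.
case: (A G) => /= [_ fG|/(_ isT) fG _].
  by rewrite gerBl mulr_ge0 // invr_ge0 ltW.
by rewrite subr_le0 mulrC ler_pdivlMr // mul1r.
Qed.

End RandomSubset.

(** * Dependence of the resolvent on a single edge *)

Section DeltaMatrices.
Variables (R : realFieldType) (n : nat).
Implicit Types (M N D : 'M[R]_n).

Lemma mul_mxdelta M N (k l i j : 'I_n) :
  (M *m delta_mx k l *m N) i j = M i k * N l j.
Proof.
rewrite mxE (bigD1 l) //= big1 ?addr0 => [|x xl]; rewrite mxE (bigD1 k) //=.
  rewrite big1 ?addr0 => [|y yk]; first by rewrite mxE !eqxx mulr1.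
  by rewrite mxE (negPf yk) mulr0.
rewrite big1 ?addr0 => [|y yk]; first by rewrite mxE (negPf xl) andbF mulr0 mul0r.
by rewrite mxE (negPf yk) mulr0.
Qed.

Lemma sub_mxE M N i j : (M - N) i j = M i j - N i j.
Proof. by rewrite 2!mxE. Qed.

Lemma opp_add_mxE M N i j : (- (M + N)) i j = - (M i j + N i j).
Proof. by rewrite 2!mxE. Qed.

Definition edge_mx (i j : 'I_n) : 'M[R]_n := delta_mx i j + delta_mx j i.

Lemma mul_edge_mx M N (c : R) (k l i j : 'I_n) :
  (M *m (c *: edge_mx k l) *m N) i j = c * (M i k * N l j + M i l * N k j).
Proof.
by rewrite -scalemxAr -scalemxAl mxE mulmxDr mulmxDl mxE !mul_mxdelta.
Qed.

Lemma dotv_delta (i : 'I_n) : dotv (delta_mx 0 i : 'rV[R]_n) (delta_mx 0 i) = 1.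
Proof.
rewrite dotvE (bigD1 i) //= mxE !eqxx mul1r big1 ?addr0 // => j ji.
by rewrite mxE (negPf ji) andbF mul0r.
Qed.

Lemma dotv_row M i : dotv (delta_mx 0 i *m M) (delta_mx 0 i *m M) =
  \sum_j M i j ^+ 2.
Proof.
by rewrite dotvE; apply: eq_bigr => j _; rewrite -rowE !mxE expr2.
Qed.

Lemma edge_mxE (i j : 'I_n) (c : R) :
  c *: edge_mx i j =
  \sum_(b : bool) c *: ((delta_mx 0 (if b then i else j) : 'rV[R]_n)^T *m
                        (delta_mx 0 (if b then j else i) : 'rV[R]_n)).
Proof.
by rewrite big_bool /= !trmx_delta !mul_delta_mx scalerDr.
Qed.

End DeltaMatrices.

Section EdgePerturbation.
Variables (R : realFieldType) (n : nat) (X X' : 'M[R]_n) (t c : R) (k l : 'I_n).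
Hypotheses (symX : X^T = X) (symX' : X'^T = X') (t_gt0 : 0 < t) (c_ge0 : 0 <= c).

Lemma resolvent_row_le i :
  \sum_j resolvent_re X t i j ^+ 2 <= t ^- 2 /\
  \sum_j resolvent_im X t i j ^+ 2 <= t ^- 2.
Proof.
have := resolvent_norm symX t_gt0 (delta_mx 0 i).
rewrite !dotv_row dotv_delta div1r => H.
have [HA HB] : 0 <= \sum_j resolvent_re X t i j ^+ 2 /\
               0 <= \sum_j resolvent_im X t i j ^+ 2.
  by split; apply: sumr_ge0 => j _; exact: sqr_ge0.
by split; apply: le_trans H; rewrite ?lerDl ?lerDr.
Qed.

Lemma resolvent_entry_le i j :
  `|resolvent_re X t i j| <= t^-1 /\ `|resolvent_im X t i j| <= t^-1.
Proof.
have [HA HB] := resolvent_row_le i.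
have H (M : 'M[R]_n) : \sum_j M i j ^+ 2 <= t ^- 2 -> `|M i j| <= t^-1.
  move=> HM; rewrite -(@ler_pXn2r _ 2) ?nnegrE ?invr_ge0 ?(ltW t_gt0) //.
  rewrite real_normK ?num_real // exprVn; apply: le_trans HM.
  by rewrite (bigD1 j) //= lerDl; apply: sumr_ge0 => x _; exact: sqr_ge0.
by split; apply: H.
Qed.

Hypothesis XE : X' - X = c *: edge_mx R k l.

Lemma trace_resolvent_edge_sub :
  `|\tr (resolvent_re X' t) - \tr (resolvent_re X t)| <= 2 * c / t ^+ 2 /\
  `|\tr (resolvent_im X' t) - \tr (resolvent_im X t)| <= 2 * c / t ^+ 2.
Proof.
have := trace_resolvent_sub symX symX' t_gt0 (etrans XE (edge_mxE k l c)).
rewrite !big_bool /= !dotv_delta (ger0_norm c_ge0).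
suff -> : c * (1 + 1) / (2 * t ^+ 2) + c * (1 + 1) / (2 * t ^+ 2) = 2 * c / t ^+ 2.
  by [].
by field; rewrite gt_eqF.
Qed.

(** The factors mix [X'] and [X], which keeps the formula exact. For [i = k] and [j = l] the
    products are the summands of [pair_sum]. *)
Lemma resolvent_re_edge_sub i j :
  resolvent_re X' t i j - resolvent_re X t i j =
  c * (resolvent_im X' t i k * resolvent_im X t l j +
       resolvent_im X' t i l * resolvent_im X t k j) -
  c * (resolvent_re X' t i k * resolvent_re X t l j +
       resolvent_re X' t i l * resolvent_re X t k j).
Proof.
have := resolvent_re_sub symX symX' t_gt0; rewrite XE => /matrixP/(_ i j).
by rewrite !sub_mxE !mul_edge_mx.
Qed.

Lemma resolvent_im_edge_sub i j :
  resolvent_im X' t i j - resolvent_im X t i j =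
  - (c * (resolvent_im X' t i k * resolvent_re X t l j +
          resolvent_im X' t i l * resolvent_re X t k j) +
     c * (resolvent_re X' t i k * resolvent_im X t l j +
          resolvent_re X' t i l * resolvent_im X t k j)).
Proof.
have := resolvent_im_sub symX symX' t_gt0; rewrite XE => /matrixP/(_ i j).
by rewrite sub_mxE opp_add_mxE !mul_edge_mx.
Qed.

End EdgePerturbation.

Lemma resolvent_entry_edge_sub (R : realFieldType) (n : nat) (X X' : 'M[R]_n)
    (t c : R) (k l i j : 'I_n) :
  X^T = X -> X'^T = X' -> 0 < t -> 0 <= c -> X' - X = c *: edge_mx R k l ->
  `|resolvent_re X' t i j - resolvent_re X t i j| <= 4 * c / t ^+ 2 /\
  `|resolvent_im X' t i j - resolvent_im X t i j| <= 4 * c / t ^+ 2.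
Proof.
move=> sX sX' t0 c0 XE.
have M2 (x y : R) : `|x| <= t^-1 -> `|y| <= t^-1 -> `|x * y| <= t ^- 2.
  by move=> hx hy; rewrite normrM -exprVn expr2 ler_pM.
have B4 (x y z w : R) : `|x| <= t ^- 2 -> `|y| <= t ^- 2 -> `|z| <= t ^- 2 ->
    `|w| <= t ^- 2 ->
    `|c * (x + y) + c * (z + w)| <= 4 * c / t ^+ 2 /\
    `|c * (x + y) - c * (z + w)| <= 4 * c / t ^+ 2.
  move=> hx hy hz hw; rewrite -mulrDr -mulrBr !normrM (ger0_norm c0).
  have -> : 4 * c / t ^+ 2 = c * (4 * t ^- 2) by ring.
  split; apply: ler_wpM2l => //.
    have := ler_normD (x + y) (z + w); have := ler_normD x y.
    have := ler_normD z w; lra.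
  have := ler_normB (x + y) (z + w); have := ler_normD x y.
  have := ler_normD z w; lra.
have E := resolvent_entry_le sX t0; have E' := resolvent_entry_le sX' t0.
have := resolvent_re_edge_sub sX sX' t0 XE i j.
have := resolvent_im_edge_sub sX sX' t0 XE i j.
move=> -> ->; rewrite normrN.
split; [apply: (B4 _ _ _ _ _ _ _ _).2 | apply: (B4 _ _ _ _ _ _ _ _).1];
  solve [apply: M2; first [apply: (E' _ _).1 | apply: (E' _ _).2 |
                           apply: (E _ _).1 | apply: (E _ _).2]].
Qed.

Section CenteredAdjacency.
Variables (R : realType) (p : R) (n : nat) (K : graph n).
Implicit Types (G : graph n) (i j : 'I_n).

Lemma tr_adjmx G : (adjmx R G)^T = adjmx R G.
Proof.
by apply/matrixP => i j; rewrite !mxE eq_sym finset.setUC.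
Qed.

Definition centered_adjmx G : 'M[R]_n :=
  (Num.sqrt n%:R)^-1 *: (adjmx R G - p *: adjmx R K).

Lemma tr_centered_adjmx G : (centered_adjmx G)^T = centered_adjmx G.
Proof. by rewrite linearZ /= linearB /= linearZ /= !tr_adjmx. Qed.

Lemma set2_eq (i j k l : 'I_n) :
  ([set i; j]%SET == [set k; l]%SET) = (i == k) && (j == l) || (i == l) && (j == k).
Proof.
apply/eqP/idP => [E|/orP[]/andP[/eqP-> /eqP->] //]; last by rewrite finset.setUC.
have : i \in [set k; l]%SET by rewrite -E set21.
have : j \in [set k; l]%SET by rewrite -E set22.
have : k \in [set i; j]%SET by rewrite E set21.
have : l \in [set i; j]%SET by rewrite E set22.
rewrite !inE (eq_sym l) (eq_sym k) (eq_sym l) (eq_sym k).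
by do 4!case: eqVneq => //= ?; subst; rewrite ?eqxx.
Qed.

Lemma adjmxU1 G i j : i != j -> [set i; j]%SET \notin G ->
  adjmx R ([set i; j]%SET |: G) - adjmx R G = edge_mx R i j.
Proof.
move=> ij eG; apply/matrixP => x y; rewrite !mxE in_setU1.
have [E|E] := eqVneq [set x; y]%SET [set i; j]%SET; last first.
  rewrite subrr; move: E; rewrite set2_eq.
  by rewrite (andbC (x == j)) => /norP[/negPf -> /negPf ->]; rewrite addr0.
rewrite E (negPf eG) andbF subr0 /=; move/eqP: E; rewrite set2_eq.
have ji : (j == i) = false by rewrite eq_sym (negPf ij).
by case/orP => /andP[/eqP -> /eqP ->];
   rewrite !eqxx ?ji ?(negPf ij) /= ?addr0 ?add0r.
Qed.

Lemma centered_adjmxU1 G i j : i != j -> [set i; j]%SET \notin G ->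
  centered_adjmx ([set i; j]%SET |: G) - centered_adjmx G =
  (Num.sqrt n%:R)^-1 *: edge_mx R i j.
Proof.
move=> ij eG; rewrite -(adjmxU1 ij eG) -scalerBr; congr (_ *: _).
by rewrite opprB addrA subrK.
Qed.

End CenteredAdjacency.

(** * Self-consistent equations for the expected traces *)

Section MissingPairs.
Variables (R : realFieldType) (n m : nat) (V : 'I_m -> {set 'I_n}) (mu : R).
Hypotheses (partV : vertex_partition V) (cardV : forall k, #|V k|%:R <= n%:R * mu).

Lemma complete_multipartite_neq (i j : 'I_n) :
  [set i; j]%SET \in complete_multipartite V -> i != j.
Proof. by rewrite finset.inE cards2 => /andP[]; case: (i == j). Qed.

(** For [i] in [V k] a missing partner [j] lies in [V k]; [j = i] is among them because [[set i; i]]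
    is a singleton. All later terms in [mu] stem from this count. *)
Lemma sum_missing_pairs_le :
  \sum_i \sum_j ([set i; j]%SET \notin complete_multipartite V)%:R <=
  n%:R ^+ 2 * mu.
Proof.
have [_ disjV coverV] := partV.
have -> : n%:R ^+ 2 * mu = \sum_(i < n) n%:R * mu.
  by rewrite sumr_const card_ord -[RHS]mulr_natl mulrA expr2.
apply: ler_sum => i _; have [k ik] := coverV i.
apply: le_trans (cardV k).
rewrite -sum1_card natr_sum [leRHS]big_mkcond /=; apply: ler_sum => j _.
case jk : (j \in V k). by case: (_ \notin _); rewrite ?ler01.
suff -> : [set i; j]%SET \in complete_multipartite V by [].
rewrite finset.inE cards2; have -> : i != j by apply: contraFneq jk => <-.
apply/forallP => k'; apply/negP; rewrite finset.subUset !finset.sub1set => /andP[ik' jk'].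
have [E|kk'] := eqVneq k k'; first by rewrite E jk' in jk.
by have := disjointFr (disjV _ _ kk') ik; rewrite ik'.
Qed.

Lemma card_complete_multipartite_le : (#|complete_multipartite V| <= n * n)%N.
Proof.
have -> : (n * n = #|{: 'I_n * 'I_n}|)%N by rewrite card_prod card_ord.
apply: leq_trans (leq_imset_card (fun ij : 'I_n * 'I_n => [set ij.1; ij.2]%SET) _).
apply/subset_leq_card/fintype.subsetP => e; rewrite finset.inE => /andP[/cards2P[i [j [ij ->]]] _].
by apply/imsetP; exists (i, j).
Qed.

End MissingPairs.

(** * Pair sums left by integration by parts, compared with products of traces *)

Section PairSums.
Variables (R : realFieldType) (n m : nat) (V : 'I_m -> {set 'I_n}) (mu t kappa : R).
Hypotheses (partV : vertex_partition V) (cardV : forall k, #|V k|%:R <= n%:R * mu).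
Hypotheses (t_gt0 : 0 < t) (kappa_gt0 : 0 < kappa) (kappa2 : kappa ^+ 2 * n%:R = 1).

Let K := complete_multipartite V.

(* The properties of the real and imaginary parts of the resolvent at [i t]  *)
(* that matter for the concentration estimates.                              *)
Definition tame (P : graph n -> 'M[R]_n) : Prop :=
  [/\ forall G i j, `|P G i j| <= t^-1,
      forall G i, \sum_j P G i j ^+ 2 <= t ^- 2
    & forall G k l i j, k != l ->
        `|P ([set k; l]%SET |: G) i j - P G i j| <= 4 * kappa / t ^+ 2].

(** What integration by parts leaves: [P] is taken with the edge present, [Q] with the edge absent.
    The diagonal products yield [\tr P] times [\tr Q]; the off-diagonal ones are of lower order. *)
Definition pair_sum (P Q : graph n -> 'M[R]_n) (G : graph n) : R :=
  \sum_i \sum_(j | [set i; j]%SET \in K)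
    (P ([set i; j]%SET |: G) i i * Q (G :\ [set i; j]%SET) j j +
     P ([set i; j]%SET |: G) i j * Q (G :\ [set i; j]%SET) i j).

(** Cauchy-Schwarz in the form [|x| <= x^2 / kappa + kappa] with [kappa = n^(-1/2)]: a row of
    squared length at most [t^-2] has absolute sum of order [sqrt n]. *)
Lemma sum_norm_tame_le (P : graph n -> 'M[R]_n) G : tame P ->
  \sum_i \sum_j `|P G i j| <= n%:R ^+ 2 * (kappa * (t ^- 2 + 1)).
Proof.
case=> _ Prow _.
have -> : n%:R ^+ 2 * (kappa * (t ^- 2 + 1)) =
    \sum_(i < n) (kappa^-1 * t ^- 2 + n%:R * kappa).
  rewrite sumr_const card_ord -[RHS]mulr_natl.
  have -> : kappa^-1 = n%:R * kappa.
    apply: (mulfI (lt0r_neq0 kappa_gt0)); rewrite mulfV ?gt_eqF //.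
    by apply: etrans (esym kappa2) _; ring.
  by ring.
apply: ler_sum => i _.
apply: (@le_trans _ _ (\sum_j (kappa^-1 * P G i j ^+ 2 + kappa))).
  apply: ler_sum => j _.
  have : 0 <= kappa^-1 * (`|P G i j| - kappa) ^+ 2.
    by rewrite mulr_ge0 ?sqr_ge0 // invr_ge0 ltW.
  rewrite -(real_normK (num_real (P G i j))).
  have -> : kappa^-1 * (`|P G i j| - kappa) ^+ 2 =
    kappa^-1 * `|P G i j| ^+ 2 + kappa - 2 * `|P G i j|.
    by field; rewrite gt_eqF.
  have := normr_ge0 (P G i j); lra.
rewrite big_split /= -mulr_sumr sumr_const card_ord -[kappa *+ n]mulr_natl lerD2r.
by rewrite ler_wpM2l ?Prow // invr_ge0 ltW.
Qed.

(** Three removals of an edge shift cost [4 kappa / t^3] each, which makes 12; the off-diagonal sum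
    adds [kappa (t^-3 + t^-1)], the missing pairs add [mu t^-2]. *)
Definition pair_error := 13%:R / t ^+ 3 + t ^- 2 + t^-1.

Lemma pair_sum_approx (P Q : graph n -> 'M[R]_n) G : tame P -> tame Q ->
  `|pair_sum P Q G - \tr (P G) * \tr (Q G)| <=
    n%:R ^+ 2 * (pair_error * (kappa + mu)).
Proof.
move=> tP tQ; have [Pe Prow Pl] := tP; have [Qe _ Ql] := tQ.
have t1 : 0 < t^-1 by rewrite invr_gt0.
pose L := 4 * kappa / t ^+ 2.
have L0 : 0 <= L by rewrite /L mulr_ge0 ?mulr_ge0 ?invr_ge0 ?exprn_ge0 ?(ltW kappa_gt0) ?(ltW t_gt0).
have Qd k l i j : k != l -> `|Q (G :\ [set k; l]%SET) i j - Q G i j| <= L.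
  move=> kl; have [eG|eG] := boolP ([set k; l]%SET \in G).
    by rewrite distrC -{1}(finset.setD1K eG); apply: Ql.
  have -> : G :\ [set k; l]%SET = G.
    by apply/finset.setDidPl; rewrite disjoint_sym disjoints1.
  by rewrite subrr normr0.
have -> : \tr (P G) * \tr (Q G) = \sum_i \sum_j P G i i * Q G j j.
  by rewrite mulr_suml; apply: eq_bigr => i _; rewrite mulr_sumr.
rewrite /pair_sum -sumrB.
apply: (@le_trans _ _ (\sum_i \sum_j (3%:R * L / t + t^-1 * `|P G i j| +
          t ^- 2 * ([set i; j]%SET \notin K)%:R))); last first.
  have -> : \sum_i \sum_j (3%:R * L / t + t^-1 * `|P G i j| +
       t ^- 2 * ([set i; j]%SET \notin K)%:R) =
    n%:R ^+ 2 * (3%:R * L / t) + t^-1 * (\sum_i \sum_j `|P G i j|) +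
    t ^- 2 * (\sum_i \sum_j ([set i; j]%SET \notin K)%:R).
    under eq_bigr => i _ do
      rewrite !big_split /= sumr_const card_ord -!mulr_sumr.
    rewrite !big_split /= sumr_const card_ord -!mulr_sumr -[_ *+ n *+ n]mulrnA.
    by rewrite -[X in X + _ + _ = _]mulr_natl natrM expr2.
  have := ler_wpM2l (ltW t1) (sum_norm_tame_le G tP).
  have := ler_wpM2l (ltW (exprn_gt0 2 t1)) (sum_missing_pairs_le partV cardV).
  rewrite exprVn => H1 H2.
  apply: le_trans (lerD (lerD (lexx _) H2) H1) _.
  rewrite -subr_ge0 /pair_error /L.
  have mu0 : 0 <= n%:R ^+ 2 * mu.
    apply: le_trans (sum_missing_pairs_le partV cardV).
    by apply: sumr_ge0 => i _; apply: sumr_ge0.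
  rewrite [leRHS](_ : _ = kappa * n%:R ^+ 2 * t ^- 2 +
     (13%:R / t ^+ 3 + t^-1) * (n%:R ^+ 2 * mu)); last first.
    by field; rewrite gt_eqF.
  by do ?[exact: mu0 | exact: ler0n | exact: ltW | apply: addr_ge0
         | apply: mulr_ge0 | rewrite invr_ge0 | apply: exprn_ge0].
apply: le_trans (ler_norm_sum _ _ _) _; apply: ler_sum => i _.
rewrite big_mkcond -sumrB /=.
apply: le_trans (ler_norm_sum _ _ _) _; apply: ler_sum => j _.
have M (x y u v : R) : `|x| <= u -> `|y| <= v -> `|x * y| <= u * v.
  by move=> hx hy; rewrite normrM ler_pM.
case: ifPn => [/complete_multipartite_neq ij|_] /=; last first.
  rewrite mulr1 sub0r normrN; apply: (@le_trans _ _ (t ^- 2)).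
    by rewrite -exprVn expr2; apply: M.
  rewrite lerDr; by do ?[exact: normr_ge0 | exact: ler0n | exact: ltW
         | exact: L0 | apply: addr_ge0 | apply: mulr_ge0].
rewrite mulr0 addr0; set e := [set i; j]%SET.
(* The shifts are undone one factor at a time; the last two terms together are the off-diagonal
   product. *)
have -> : P (e |: G) i i * Q (G :\ e) j j + P (e |: G) i j * Q (G :\ e) i j -
    P G i i * Q G j j =
  (P (e |: G) i i - P G i i) * Q (G :\ e) j j +
  P G i i * (Q (G :\ e) j j - Q G j j) +
  (P (e |: G) i j - P G i j) * Q (G :\ e) i j + P G i j * Q (G :\ e) i j.
  by ring.
have H1 := M _ _ _ _ (Pl G i j i i ij) (Qe (G :\ e) j j).
have H2 := M _ _ _ _ (Pe G i i) (Qd i j j j ij).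
have H3 := M _ _ _ _ (Pl G i j i j ij) (Qe (G :\ e) i j).
have H4 := M _ _ _ _ (lexx `|P G i j|) (Qe (G :\ e) i j).
move: H1 H2 H3 H4; rewrite -/e -/L.
set x1 := (_ - _) * _; set x2 := _ * (_ - _); set x3 := (_ - _) * _; set x4 := P G i j * _.
move=> H1 H2 H3 H4.
have := ler_normD (x1 + x2 + x3) x4; have := ler_normD (x1 + x2) x3.
have := ler_normD x1 x2; lra.
Qed.

End PairSums.

(** * The semicircle equation and its stability *)

Section SemicircleTransform.
Variable R : realType.
Implicit Types s t : R.

(* The imaginary part at [i t] of the Stieltjes transform of the semicircle  *)
(* law of variance [s], i.e. the positive root of [s h^2 + t h = 1].         *)
Definition semicircle_im s t : R := 2 / (t + Num.sqrt (t ^+ 2 + 4 * s)).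

(** The hypotheses admit [t = 0] when [s > 0], the left end of the Riemann sum, and [s = 0] when
    [t > 0], the case [p = 0] or [p = 1]. *)
Lemma semicircle_denom_gt0 s t : 0 <= s -> 0 <= t -> 0 < s + t ->
  0 < t + Num.sqrt (t ^+ 2 + 4 * s).
Proof.
move=> s0; rewrite le_eqVlt => /predU1P[<-|t0 _].
  by rewrite addr0 expr0n add0r => s_gt0; rewrite add0r sqrtr_gt0 mulr_gt0.
by rewrite ltr_wpDr // sqrtr_ge0.
Qed.

Lemma semicircle_im_gt0 s t : 0 <= s -> 0 <= t -> 0 < s + t ->
  0 < semicircle_im s t.
Proof. by move=> s0 t0 st; rewrite divr_gt0 // semicircle_denom_gt0. Qed.

Lemma semicircle_imE s t : 0 <= s -> 0 <= t -> 0 < s + t ->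
  t * semicircle_im s t + s * semicircle_im s t ^+ 2 = 1.
Proof.
move=> s0 t0 st; have := semicircle_denom_gt0 s0 t0 st.
rewrite /semicircle_im; set D := Num.sqrt _ => /lt0r_neq0 tD.
have D2 : D ^+ 2 = t ^+ 2 + 4 * s.
  by rewrite sqr_sqrtr // addr_ge0 ?sqr_ge0 ?mulr_ge0.
apply: (mulIf (expf_neq0 2 tD)); rewrite mul1r.
rewrite [LHS](_ : _ = 2 * t * (t + D) + 4 * s); last by field.
by rewrite sqrrD D2; ring.
Qed.

(** Let [w = eps + 2 v]. Since [b >= 0], the second equation gives [t |a| <= w], hence
    [s a^2 <= w / t^2]. Then [(h - b) (t + s (h + b)) = 1 - t b - s b^2] is at most [w (1 + t^-2)]
    in size, and its second factor is at least [t] because [h] and [b] are nonnegative. *)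
Lemma semicircle_im_stability s t (eps v a b a2 b2 ab : R) :
  0 <= s <= 1 -> 0 < t -> 0 <= b -> `|a| <= t^-1 ->
  `|1 - t * b - s * (b2 - a2)| <= eps -> `|t * a + 2 * s * ab| <= eps ->
  `|a2 - a * a| <= v -> `|b2 - b * b| <= v -> `|ab - a * b| <= v ->
  `|b - semicircle_im s t| <= (eps + 2 * v) * (1 + t ^- 2) / t.
Proof.
move=> /andP[s0 s1] t0 b0 at1 H1 H2 Ha2 Hb2 Hab; set w := eps + 2 * v.
have v0 : 0 <= v := le_trans (normr_ge0 _) Ha2.
have M x : `|x| <= v -> `|s * x| <= v.
  by move=> xv; rewrite normrM (ger0_norm s0) -[leRHS]mul1r ler_pM.
have {}H1 : `|1 - t * b - s * (b * b - a * a)| <= w.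
  have -> : 1 - t * b - s * (b * b - a * a) =
     (1 - t * b - s * (b2 - a2)) + s * (b2 - b * b) - s * (a2 - a * a) by ring.
  apply: le_trans (ler_normB _ _) _; have := ler_normD (1 - t * b - s * (b2 - a2)) (s * (b2 - b * b)).
  by have := M _ Ha2; have := M _ Hb2; rewrite /w; lra.
have {}H2 : `|a| * t <= w.
  have E : `|t * a + 2 * s * (a * b)| <= w.
    have -> : t * a + 2 * s * (a * b) =
      (t * a + 2 * s * ab) - 2 * (s * (ab - a * b)) by ring.
    apply: le_trans (ler_normB _ _) _; rewrite [`|2 * _|]normrM ger0_norm //.
    by have := M _ Hab; rewrite /w; lra.
  apply: le_trans E; have -> : t * a + 2 * s * (a * b) = a * (t + 2 * s * b) by ring.
  rewrite normrM ler_wpM2l // (le_trans _ (ler_norm _)) // lerDl.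
  by rewrite mulr_ge0 ?mulr_ge0.
have tn0 : t != 0 by rewrite gt_eqF.
have aa : s * (a * a) <= w * t ^- 2.
  have -> : a * a = `|a| * `|a| by rewrite -normrM ger0_norm // -expr2 sqr_ge0.
  apply: (@le_trans _ _ (`|a| * `|a|)).
    by rewrite -[leRHS]mul1r ler_wpM2r // mulr_ge0.
  have -> : w * t ^- 2 = (w / t) * t^-1 by field.
  by apply: ler_pM => //; rewrite ler_pdivlMr.
have aa0 : 0 <= s * (a * a) by rewrite mulr_ge0 // -expr2 sqr_ge0.
have st : 0 < s + t by rewrite ltr_wpDl.
set h := semicircle_im s t; have h0 : 0 < h := semicircle_im_gt0 s0 (ltW t0) st.
have hE : t * h + s * h ^+ 2 = 1 := semicircle_imE s0 (ltW t0) st.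
have E : (h - b) * (t + s * (h + b)) = 1 - t * b - s * b ^+ 2 by rewrite -hE; ring.
have {}H1 : `|(h - b) * (t + s * (h + b))| <= w * (1 + t ^- 2).
  rewrite E.
  have -> : 1 - t * b - s * b ^+ 2 =
    1 - t * b - s * (b * b - a * a) - s * (a * a) by ring.
  apply: le_trans (ler_normB _ _) _; rewrite [`|s * (a * a)|]ger0_norm //; lra.
rewrite ler_pdivlMr // distrC; apply: le_trans H1; rewrite normrM ler_wpM2l //.
by rewrite (le_trans _ (ler_norm _)) // lerDl mulr_ge0 // addr_ge0 // ltW.
Qed.

End SemicircleTransform.

(** A diagonal entry of [Q^-1] is the quadratic form of [Q] at a row of [Q^-1]. This sign selects
    the positive root later. *)
Lemma resolvent_im_diag_ge0 (R : realFieldType) (n : nat) (X : 'M[R]_n) (t : R) (i : 'I_n) :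
  X^T = X -> 0 < t -> 0 <= resolvent_im X t i i.
Proof.
move=> symX t0; rewrite mxE mulr_ge0 ?(ltW t0) //.
set u : 'rV[R]_n := delta_mx 0 i; set Q := sqshift X t.
have -> : invmx Q i i = dotv (u *m invmx Q) u.
  rewrite dotvE (bigD1 i) //= -rowE !mxE !eqxx mulr1 big1 ?addr0 // => j ji.
  by rewrite [X in _ * X]mxE (negPf ji) andbF mulr0.
rewrite -{2}(mulmxKV (sqshift_unit symX t0) u) dotvC dotv_sqshift //.
by apply: addr_ge0; [exact: dotv_ge0|apply: mulr_ge0; [exact: sqr_ge0|exact: dotv_ge0]].
Qed.

(** * The expected traces nearly solve the semicircle equation *)

Section SelfConsistency.
Variables (R : realType) (p : R) (n m : nat) (V : 'I_m -> {set 'I_n}) (mu t : R).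
Hypotheses (p01 : 0 <= p <= 1) (n_gt0 : (0 < n)%N) (partV : vertex_partition V).
Hypotheses (cardV : forall k, #|V k|%:R <= n%:R * mu) (t_gt0 : 0 < t).

Let K := complete_multipartite V.
Let kappa : R := (Num.sqrt n%:R)^-1.
Let s := p * (1 - p).
Let X := centered_adjmx p K.
Let A G := resolvent_re (X G) t.
Let B G := resolvent_im (X G) t.
Let a G := \tr (A G) / n%:R.
Let b G := \tr (B G) / n%:R.

Let n0 : (0 : R) < n%:R. Proof. by rewrite ltr0n. Qed.

Let kappa_gt0 : 0 < kappa. Proof. by rewrite invr_gt0 sqrtr_gt0. Qed.

Let kappa2 : kappa ^+ 2 * n%:R = 1.
Proof. by rewrite /kappa exprVn sqr_sqrtr ?ler0n // mulVf ?gt_eqF. Qed.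

Let s01 : 0 <= s <= 1.
Proof. by rewrite /s; move: p01 => /andP[p0 p1]; apply/andP; split; nra. Qed.

Let symX G : (X G)^T = X G. Proof. exact: tr_centered_adjmx. Qed.

Let tame_AB : tame t kappa A /\ tame t kappa B.
Proof.
have L (P : graph n -> 'M[R]_n) :
  (forall (G : graph n) k l i j, k != l -> [set k; l]%SET \notin G ->
     `|P ([set k; l]%SET |: G) i j - P G i j| <= 4 * kappa / t ^+ 2) ->
  forall (G : graph n) k l i j, k != l ->
     `|P ([set k; l]%SET |: G) i j - P G i j| <= 4 * kappa / t ^+ 2.
  move=> H G k l i j kl; have [eG|] := boolP ([set k; l]%SET \in G); last exact: H.
  rewrite (finset.setUidPr _) ?finset.sub1set // subrr normr0.
  by rewrite divr_ge0 ?mulr_ge0 ?sqr_ge0 // ltW.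
split; split=> [G i j|G i|]; try by
  [ apply: (resolvent_entry_le (symX G) t_gt0 i j).1
  | apply: (resolvent_entry_le (symX G) t_gt0 i j).2
  | apply: (resolvent_row_le (symX G) t_gt0 i).1
  | apply: (resolvent_row_le (symX G) t_gt0 i).2].
- apply: L => G k l i j kl eG.
  apply: (resolvent_entry_edge_sub _ _ (symX _) (symX _) t_gt0 (ltW kappa_gt0)
            (centered_adjmxU1 _ _ kl eG)).1.
- apply: L => G k l i j kl eG.
  apply: (resolvent_entry_edge_sub _ _ (symX _) (symX _) t_gt0 (ltW kappa_gt0)
            (centered_adjmxU1 _ _ kl eG)).2.
Qed.

Let v := (2 * kappa / t ^+ 2) ^+ 2.

(** One edge moves a normalized trace by at most [2 kappa / (t^2 n)], and there are at most [n^2]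
    edges; the powers of [n] cancel in the Efron-Stein bound. *)
Let variance_le : variance p K a <= v /\ variance p K b <= v.
Proof.
have E (P : graph n -> 'M[R]_n) :
  (forall (G : graph n) k l, k != l -> [set k; l]%SET \notin G ->
     `|\tr (P ([set k; l]%SET |: G)) - \tr (P G)| <= 2 * kappa / t ^+ 2) ->
  variance p K (fun G => \tr (P G) / n%:R) <= v.
  move=> H; have c0 : 0 <= 2 * kappa / t ^+ 2 by rewrite divr_ge0 ?mulr_ge0 ?sqr_ge0 // ltW.
  have c0' : 0 <= 2 * kappa / t ^+ 2 / n%:R by rewrite divr_ge0 // ltW.
  apply: (@le_trans _ _ (#|K|%:R * (2 * kappa / t ^+ 2 / n%:R) ^+ 2)).
    apply: efron_stein => // e G; rewrite finset.inE => /andP[/cards2P[k [l [kl ->]]] _].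
    rewrite -mulrBl normrM [`|n%:R^-1|]gtr0_norm ?invr_gt0 //.
    rewrite ler_wpM2r ?invr_ge0 ?ler0n //.
    have [eG|] := boolP ([set k; l]%SET \in G); last exact: H.
    by rewrite (finset.setUidPr _) ?finset.sub1set // subrr normr0.
  apply: (@le_trans _ _ ((n * n)%:R * (2 * kappa / t ^+ 2 / n%:R) ^+ 2)).
    by rewrite ler_wpM2r ?sqr_ge0 // ler_nat card_complete_multipartite_le.
  by rewrite natrM [leLHS](_ : _ = v) //; rewrite /v; field; rewrite !gt_eqF.
split; apply: E => G k l kl eG.
- by apply: (trace_resolvent_edge_sub (symX _) (symX _) t_gt0 (ltW kappa_gt0)
            (centered_adjmxU1 _ _ kl eG)).1.
- by apply: (trace_resolvent_edge_sub (symX _) (symX _) t_gt0 (ltW kappa_gt0)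
            (centered_adjmxU1 _ _ kl eG)).2.
Qed.

(** For [G] inside [K], an entry of [X G] is [kappa] times a centered edge indicator at a pair of
    [K] and zero elsewhere, so each entry is integrated by parts in its own edge. *)
Let expect_trace_mul (P : graph n -> 'M[R]_n) : (forall G, (P G)^T = P G) ->
  expect p K (fun G => \tr (X G *m P G)) =
  kappa * s * \sum_i \sum_(j | [set i; j]%SET \in K)
     expect p K (fun G => P ([set i; j]%SET |: G) i j - P (G :\ [set i; j]%SET) i j).
Proof.
move=> symP.
rewrite (@eq_expect _ _ _ _ _ (fun G => kappa * \sum_i \sum_(j | [set i; j]%SET \in K)
   (([set i; j]%SET \in G)%:R - p) * P G i j)).
  rewrite expectZ expect_sum -mulrA; congr (_ * _).
  rewrite big_distrr /=; apply: eq_bigr => i _.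
  rewrite expect_sum big_distrr /=; apply: eq_bigr => j eK.
  exact: expect_integration_by_parts.
move=> G /fintype.subsetP GK; rewrite /mxtrace big_distrr /=; apply: eq_bigr => i _.
rewrite mxE [in RHS]big_mkcond big_distrr /=; apply: eq_bigr => j _.
rewrite -[in P G j i]symP [(P G)^T j i]mxE /X !mxE.
case: ifPn => [/complete_multipartite_neq ->|eK]; first by rewrite /= mulr1 mulrA.
rewrite andbF (_ : _ \in G = false) ?andbF ?mulr0 ?subr0 ?mulr0 ?mul0r //.
by apply: contraNF eK; apply: GK.
Qed.

Let edge_diff G i j : i != j ->
  X ([set i; j]%SET |: G) - X (G :\ [set i; j]%SET) = kappa *: edge_mx R i j.
Proof.
move=> ij; set e := [set i; j]%SET.
rewrite -(@centered_adjmxU1 R p n K (G :\ e)) ?setD11 //.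
congr (X _ - _); apply/finset.setP => x; rewrite !finset.inE.
by case: (x == e).
Qed.

Let trE (P : graph n -> 'M[R]_n) : expect p K (fun G => \tr (P G) / n%:R) =
   expect p K (fun G => \tr (P G)) / n%:R.
Proof.
by rewrite mulrC -expectZ; apply: eq_expect => G _; rewrite mulrC.
Qed.

Let e0 := pair_error t * (kappa + mu).

Let pair_expect (P Q : graph n -> 'M[R]_n) : tame t kappa P -> tame t kappa Q ->
  `|expect p K (pair_sum V P Q) / n%:R ^+ 2 -
    expect p K (fun G => (\tr (P G) / n%:R) * (\tr (Q G) / n%:R))| <= e0.
Proof.
move=> tP tQ; rewrite mulrC -expectZ -expectB; apply: expect_norm_le => // G _.
have -> : n%:R ^- 2 * pair_sum V P Q G - (\tr (P G) / n%:R) * (\tr (Q G) / n%:R) =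
    n%:R ^- 2 * (pair_sum V P Q G - \tr (P G) * \tr (Q G)).
  by field; rewrite gt_eqF.
rewrite normrM ger0_norm ?invr_ge0 ?sqr_ge0 // mulrC ler_pdivrMr ?exprn_gt0 //.
by rewrite [leRHS]mulrC; apply: pair_sum_approx.
Qed.

Let sum_pairE (P Q : graph n -> 'M[R]_n) :
  \sum_i \sum_(j | [set i; j]%SET \in K) expect p K (fun G =>
    kappa * (P ([set i; j]%SET |: G) i i * Q (G :\ [set i; j]%SET) j j +
     P ([set i; j]%SET |: G) i j * Q (G :\ [set i; j]%SET) i j)) =
  kappa * expect p K (pair_sum V P Q).
Proof.
rewrite expect_sum big_distrr /=; apply: eq_bigr => i _.
by rewrite expect_sum big_distrr /=; apply: eq_bigr => j _; rewrite expectZ.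
Qed.

(** The trace of [X A + t B = 1], with [\tr (X A)] integrated by parts. One [kappa] comes from the
    entry of [X], the other from changing one edge, together [1 / n]. Each of the two pair sums
    costs [e0]. *)
Let self_consistent_re :
  `|1 - t * expect p K b - s * (expect p K (fun G => b G * b G) -
                               expect p K (fun G => a G * a G))| <= 2 * e0.
Proof.
have [tA tB] := tame_AB.
have H : n%:R - t * expect p K (fun G => \tr (B G)) =
   kappa ^+ 2 * s * (expect p K (pair_sum V B B) - expect p K (pair_sum V A A)).
  rewrite -expectZ -[X in X - _](expect_cst p K) -[LHS]expectB.
  rewrite (@eq_expect _ _ _ _ _ (fun G => \tr (X G *m A G))); last first.
    move=> G _; have := mul_resolvent_re (symX G) t_gt0.
    move=> /(congr1 mxtrace); rewrite mxtraceD mxtraceZ mxtrace1 => <-.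
    by rewrite addrK.
  rewrite expect_trace_mul; last by move=> G; apply: tr_resolvent_re.
  rewrite [X in _ * X = _](_ : _ = kappa * (expect p K (pair_sum V B B) -
    expect p K (pair_sum V A A))); first by ring.
  rewrite mulrBr -!sum_pairE -sumrB; apply: eq_bigr => i _.
  rewrite -sumrB; apply: eq_bigr => j /complete_multipartite_neq ij.
  rewrite -expectB; apply: eq_expect => G _.
  exact: (resolvent_re_edge_sub (symX _) (symX _) t_gt0 (edge_diff G ij)).
have -> : 1 - t * expect p K b =
   s * (expect p K (pair_sum V B B) / n%:R ^+ 2 - expect p K (pair_sum V A A) / n%:R ^+ 2).
  rewrite trE; apply: (mulIf (lt0r_neq0 n0)).
  rewrite [LHS](_ : _ = n%:R - t * expect p K (fun G => \tr (B G))); last first.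
    by field; rewrite gt_eqF.
  rewrite H.
  have -> : kappa ^+ 2 = n%:R^-1.
    by apply: (mulIf (lt0r_neq0 n0)); rewrite kappa2 mulVf ?gt_eqF.
  by field; rewrite gt_eqF.
have := pair_expect tB tB; have := pair_expect tA tA; rewrite -/(a _) -/(b _).
set x := _ / _; set y := expect _ _ _; set z := _ / _; set w := expect _ _ _ => H1 H2.
have -> : s * (z - x) - s * (w - y) = s * ((z - w) - (x - y)) by ring.
have [s0 s1] := andP s01.
rewrite normrM (ger0_norm s0) -[leRHS]mul1r ler_pM //.
by have := ler_normB (z - w) (x - y); lra.
Qed.

(** The same for the trace of [X B = t A]. Both mixed pair sums approximate [E (a b)], whence the
    factor 2; the sign is that of the imaginary part of the resolvent identity. *)
Let self_consistent_im :
  `|t * expect p K a + 2 * s * expect p K (fun G => a G * b G)| <= 2 * e0.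
Proof.
have [tA tB] := tame_AB.
have H : t * expect p K (fun G => \tr (A G)) =
   - (kappa ^+ 2 * s * (expect p K (pair_sum V B A) + expect p K (pair_sum V A B))).
  rewrite -expectZ.
  rewrite (@eq_expect _ _ _ _ _ (fun G => \tr (X G *m B G))); last first.
    move=> G _; have := mul_resolvent_im (symX G) t_gt0.
    by move=> /(congr1 mxtrace); rewrite mxtraceZ.
  rewrite expect_trace_mul; last by move=> G; apply: tr_resolvent_im.
  rewrite [X in _ * X = _](_ : _ = - (kappa * (expect p K (pair_sum V B A) +
    expect p K (pair_sum V A B)))); first by ring.
  rewrite mulrDr -!sum_pairE -big_split /= -sumrN; apply: eq_bigr => i _.
  rewrite -big_split /= -sumrN; apply: eq_bigr => j /complete_multipartite_neq ij.
  rewrite -expectD -expectN; apply: eq_expect => G _.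
  exact: (resolvent_im_edge_sub (symX _) (symX _) t_gt0 (edge_diff G ij)).
have -> : t * expect p K a =
   - (s * (expect p K (pair_sum V B A) / n%:R ^+ 2 + expect p K (pair_sum V A B) / n%:R ^+ 2)).
  rewrite trE; apply: (mulIf (lt0r_neq0 n0)).
  rewrite [LHS](_ : _ = t * expect p K (fun G => \tr (A G))); last first.
    by field; rewrite gt_eqF.
  rewrite H.
  have -> : kappa ^+ 2 = n%:R^-1.
    by apply: (mulIf (lt0r_neq0 n0)); rewrite kappa2 mulVf ?gt_eqF.
  by field; rewrite gt_eqF.
have := pair_expect tB tA; have := pair_expect tA tB; rewrite -/(a _) -/(b _).
rewrite [expect p K (fun G => b G * a G)](@eq_expect _ _ _ _ _ (fun G => a G * b G)); last first.
  by move=> G _; rewrite mulrC.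
set x := _ / _; set y := expect _ _ _; set z := _ / _ => H1 H2.
have -> : - (s * (z + x)) + 2 * s * y = - (s * ((z - y) + (x - y))) by ring.
have [s0 s1] := andP s01.
rewrite normrN normrM (ger0_norm s0) -[leRHS]mul1r ler_pM //.
by have := ler_normD (z - y) (x - y); lra.
Qed.

(** Fluctuation plus bias: [2 kappa / t^2] is the square root of [v] and bounds the mean of
    [|b - E b|]; the rest is the stability estimate with [eps = 2 e0]. *)
Lemma expect_semicircle_dist :
  expect p K (fun G => `|\tr (resolvent_im (centered_adjmx p K G) t) / n%:R -
                         semicircle_im s t|) <=
  2 * kappa / t ^+ 2 +
  (2 * (pair_error t * (kappa + mu)) + 2 * (2 * kappa / t ^+ 2) ^+ 2) *
     (1 + t ^- 2) / t.
Proof.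
have [va vb] := variance_le; have [tA tB] := tame_AB.
have cov (f g : graph n -> R) : variance p K f <= v -> variance p K g <= v ->
    `|expect p K (fun G => f G * g G) - expect p K f * expect p K g| <= v.
  by move=> hf hg; have := norm_covariance_le p01 K f g; lra.
have b0 : 0 <= expect p K b.
  rewrite -(expect_cst p K 0); apply: ler_expect => // G _.
  rewrite divr_ge0 ?ler0n // /mxtrace sumr_ge0 // => i _.
  exact: resolvent_im_diag_ge0.
have a1 : `|expect p K a| <= t^-1.
  apply: expect_norm_le => // G _.
  rewrite normrM [`|n%:R^-1|]gtr0_norm ?invr_gt0 // ler_pdivrMr //.
  apply: le_trans (ler_norm_sum _ _ _) _.
  rewrite mulr_natr -[X in _ *+ X]card_ord -sumr_const; apply: ler_sum => i _.
  by case: tA.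
have stab := semicircle_im_stability s01 t_gt0 b0 a1 self_consistent_re
  self_consistent_im (cov _ _ va va) (cov _ _ vb vb) (cov _ _ va vb).
rewrite -/e0; apply: le_trans (_ : expect p K (fun G => `|b G - expect p K b| +
   `|expect p K b - semicircle_im s t|) <= _).
  apply: ler_expect => // G _; rewrite -[X in `|X|](subrKA (expect p K b)); exact: ler_normD.
rewrite expectD expect_cst; apply: lerD stab.
have := sqr_expect_le p01 K (fun G => `|b G - expect p K b|).
rewrite [X in _ <= X](@eq_expect _ _ _ _ _ (fun G => (b G - expect p K b) ^+ 2)); last first.
  by move=> G _; rewrite real_normK ?num_real.
move=> /le_trans/(_ vb) H.
rewrite -(@ler_pXn2r _ 2) ?nnegrE; [|by []|..]; last 2 first.
- by rewrite -(expect_cst p K 0); apply: ler_expect.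
- by rewrite divr_ge0 ?mulr_ge0 ?sqr_ge0 // ltW.
exact: H.
Qed.

End SelfConsistency.

(** * Removing the centering *)

Section Uncentered.
Variables (R : realType) (p : R) (n m : nat) (V : 'I_m -> {set 'I_n}) (t : R).
Hypotheses (p01 : 0 <= p <= 1) (n_gt0 : (0 < n)%N) (partV : vertex_partition V).
Hypothesis t_gt0 : 0 < t.

Let K := complete_multipartite V.
Let kappa : R := (Num.sqrt n%:R)^-1.

(** The left index stands for the all-ones vector, [inr k] for the indicator of a part: [adj K] is
    the all-ones matrix minus one block per part. *)
Definition part_vector (k : unit + 'I_m) : 'rV[R]_n :=
  if k is inr k then \row_j (j \in V k)%:R else const_mx 1.

Lemma sum_part_mem (F : 'I_m -> R) (i : 'I_n) (k : 'I_m) : i \in V k ->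
  \sum_k' (i \in V k')%:R * F k' = F k.
Proof.
have [_ disjV _] := partV; move=> ik; rewrite (bigD1 k) //= ik mul1r.
rewrite big1 ?addr0 // => k' kk'.
by rewrite (disjointFr (disjV k k' _) ik) ?mul0r // eq_sym.
Qed.

Lemma adjmx_complete_multipartite :
  adjmx R K = \sum_k (if k is inr _ then -1 else 1) *:
                ((part_vector k)^T *m part_vector k).
Proof.
have [_ disjV coverV] := partV.
apply/matrixP => i j; rewrite summxE big_sumType (big_pred1 tt); last by case.
rewrite /= !mxE big_ord1 !mxE !mul1r.
have [k ik] := coverV i.
rewrite (eq_bigr (fun k' => (i \in V k')%:R * - (j \in V k')%:R)); last first.
  by move=> k' _; rewrite !mxE big_ord1 !mxE mulN1r mulrN.
rewrite (sum_part_mem _ ik).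
case jk : (j \in V k).
  rewrite subrr; case: (boolP (_ && _)) => // /andP[_].
  rewrite finset.inE => /andP[_ /forallP/(_ k)].
  by rewrite finset.subUset !finset.sub1set ik jk.
have ij : i != j by apply: contraFneq jk => <-.
rewrite oppr0 addr0 ij finset.inE cards2 ij /= (_ : [forall _, _]) //.
apply/forallP => k'; apply/negP; rewrite finset.subUset !finset.sub1set => /andP[ik' jk'].
have [E|kk'] := eqVneq k k'; first by rewrite E jk' in jk.
by have := disjointFr (disjV _ _ kk') ik; rewrite ik'.
Qed.

(** The all-ones vector contributes [n], and so do the indicators together, however many parts tile
    the vertex set. *)
Lemma sum_dotv_part_vector :
  \sum_k dotv (part_vector k) (part_vector k) = 2 * n%:R.
Proof.
have [_ _ coverV] := partV.
rewrite big_sumType (big_pred1 tt); last by case.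
rewrite dotvE (eq_bigr (fun=> 1)) => [|i _]; last by rewrite !mxE mulr1.
rewrite sumr_const card_ord (_ : \sum_(k | _) _ = n%:R); last first.
  under eq_bigr => k _ do rewrite dotvE.
  rewrite exchange_big /= -[n in RHS]card_ord -sumr_const; apply: eq_bigr => i _.
  have [k ik] := coverV i; apply: etrans (_ : _ = _) (sum_part_mem (fun=> 1) ik).
  by apply: eq_bigr => k' _; rewrite /= !mxE; case: (i \in V k'); rewrite ?mulr1 ?mulr0.
by rewrite mulr_natl mulr2n.
Qed.

Lemma trace_resolvent_uncentered (G : graph n) :
  `|\tr (resolvent_im ((Num.sqrt n%:R)^-1 *: adjmx R G) t) / n%:R -
    \tr (resolvent_im (centered_adjmx p K G) t) / n%:R| <= 2 * kappa / t ^+ 2.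
Proof.
have n0 : (0 : R) < n%:R by rewrite ltr0n.
have k0 : 0 < kappa by rewrite invr_gt0 sqrtr_gt0.
set Y := _ *: adjmx R G; set X := centered_adjmx p K G.
have symY : Y^T = Y by rewrite linearZ /= tr_adjmx.
pose c (k : unit + 'I_m) : R := p * kappa * (if k is inr _ then -1 else 1).
have E : Y - X = \sum_k c k *: ((part_vector k)^T *m part_vector k).
  rewrite /X /centered_adjmx -scalerBr opprB addrCA subrr addr0 scalerA.
  rewrite adjmx_complete_multipartite scaler_sumr; apply: eq_bigr => k _.
  by rewrite scalerA /c -/kappa [kappa * p]mulrC.
have [_] := trace_resolvent_sub (tr_centered_adjmx p K G) symY t_gt0 E.
have -> : \sum_k `|c k| * (dotv (part_vector k) (part_vector k) +
    dotv (part_vector k) (part_vector k)) / (2 * t ^+ 2) = p * (2 * kappa / t ^+ 2 * n%:R).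
  have -> : p * (2 * kappa / t ^+ 2 * n%:R) =
     p * kappa / t ^+ 2 * (\sum_k dotv (part_vector k) (part_vector k)).
    by rewrite sum_dotv_part_vector; ring.
  rewrite mulr_sumr; apply: eq_bigr => k _.
  have -> : `|c k| = p * kappa.
    have pk : 0 <= p * kappa by rewrite mulr_ge0 ?(ltW k0) //; case/andP: p01.
    by rewrite /c; case: k => [k|]; rewrite ?mulrN1 ?normrN ?mulr1 ger0_norm.
  by field; rewrite gt_eqF.
move=> H; rewrite -mulrBl normrM [`|n%:R^-1|]gtr0_norm ?invr_gt0 //.
rewrite ler_pdivrMr //; apply: le_trans H _.
rewrite -[leRHS]mul1r ler_wpM2r //; last by case/andP: p01.
by rewrite mulr_ge0 ?ler0n // divr_ge0 ?mulr_ge0 ?sqr_ge0 // ltW.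
Qed.

End Uncentered.

(** * Energy and resolvent in terms of the spectrum *)

Lemma invmx_conj_diag (F : fieldType) (n : nat) (P : 'M[F]_n) (u : 'rV[F]_n) :
  P \in unitmx -> (forall i, u 0 i != 0) ->
  invmx (invmx P *m diag_mx u *m P) = invmx P *m diag_mx (\row_i (u 0 i)^-1) *m P.
Proof.
move=> PU u0; set M := invmx P *m _ *m P; set N := invmx P *m _ *m P.
have E : M *m N = 1%:M.
  rewrite /M /N !mulmxA mulmxK // -(mulmxA (invmx P)) mulmx_diag.
  rewrite (_ : diag_mx _ = 1%:M) ?mulmx1 ?mulVmx //.
  apply/matrixP => i j; rewrite !mxE; case: eqVneq => // _.
  by rewrite mulfV.
by have [U _] := mulmx1_unit E; rewrite -[LHS]mulmx1 -E mulKmx.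
Qed.

(** One family [d] has to serve the energy, the second moment and every resolvent at once. It comes
    from the unitary diagonalization over the complex numbers and is real because the matrix is
    Hermitian; [c] accommodates the scaling by [n^(-1/2)]. *)
Lemma symmetric_spectrum (R : realType) (n : nat) (A : 'M[R]_n) : A^T = A ->
  exists d : 'I_n -> R,
    [/\ forall F : R -> R, \sum_(x <- eigenvalues A) F x = \sum_i F (d i),
        \tr (A *m A) = \sum_i d i ^+ 2
      & forall c t : R, 0 < t ->
          \tr (invmx (sqshift (c *: A) t)) = \sum_i ((c * d i) ^+ 2 + t ^+ 2)^-1].
Proof.
move=> symA; pose C : numClosedFieldType := complex.complex R.
pose f : {rmorphism R -> C} := @complex.real_complex_def R (Phant R).
pose B : 'M[C]_n := map_mx f A.
have realB : B \is a mxOver Num.real.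
  by apply/mxOverP => i j; rewrite mxE complex.complex_real.
have hermB : B \is sesquilinear.hermitianmx n false Num.conj.
  apply: spectral.realsym_hermsym => //; apply/sesquilinear.is_hermitianmxP.
  by rewrite expr0 scale1r map_mx_id // /B map_trmx symA.
have /spectral.orthomx_spectralP DB := spectral.hermitian_normalmx hermB.
have /mxOverP realD := spectral.hermitian_spectral_diag_real hermB.
set P := spectral.spectralmx B in DB.
set e := spectral.spectral_diag B in DB realD.
have PU : P \in unitmx := spectral.spectral_unit B.
pose d i := complex.Re (e 0 i).
have fd i : f (d i) = e 0 i by rewrite /d /f /= complex.RRe_real.
have trP D : \tr (invmx P *m D *m P) = \tr D by rewrite mxtrace_mulC mulmxA mulmxV // mul1mx.
have ftr (M : 'M[R]_n) : f (\tr M) = \tr (map_mx f M) by rewrite trace_map_mx.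
pose eM := diag_mx e.
have BM : map_mx f A = invmx P *m eM *m P by exact: DB.
exists d; split.
- have DA : char_poly A = \prod_(i < n) ('X - (d i)%:P).
    apply: (map_poly_inj f); rewrite map_char_poly -/B.
    have -> : char_poly B = char_poly (diag_mx e).
      rewrite DB /char_poly /char_poly_mx.
      have -> : 'X%:M - map_mx polyC (invmx P *m diag_mx e *m P) =
          map_mx polyC (invmx P) *m ('X%:M - map_mx polyC (diag_mx e))
            *m map_mx polyC P.
        rewrite mulmxBr mulmxBl !map_mxM /=; congr (_ - _).
        by rewrite scalar_mxC -mulmxA -map_mxM mulVmx // map_mx1 mulmx1.
      rewrite !det_mulmx mulrAC -det_mulmx -map_mxM mulVmx //.
      by rewrite map_mx1 det1 mul1r.
    rewrite char_poly_trig ?diag_mx_is_trig // rmorph_prod /=.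
    by apply: eq_bigr => i _; rewrite map_polyXsubC /= mxE eqxx mulr1n fd.
  have E : perm_eq (eigenvalues A) [seq d i | i <- index_enum 'I_n].
    apply/allP => x _ /=; rewrite -!mu_prod_XsubC -char_poly_sym //.
    by rewrite big_map -DA.
  by move=> F; rewrite (perm_big _ E) big_map.
- apply: (fmorph_inj f); rewrite ftr map_mxM BM.
  have -> : invmx P *m eM *m P *m (invmx P *m eM *m P) = invmx P *m (eM *m eM) *m P.
    by rewrite !mulmxA mulmxK.
  rewrite trP mulmx_diag mxtrace_diag rmorph_sum; apply: eq_bigr => i _.
  by rewrite mxE rmorphXn fd expr2.
- move=> c t t0; apply: (fmorph_inj f); rewrite ftr map_invmx.
  pose w : 'rV[C]_n := \row_i f ((c * d i) ^+ 2 + t ^+ 2).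
  have -> : map_mx f (sqshift (c *: A) t) = invmx P *m diag_mx w *m P.
    rewrite map_mxD map_mxM map_mxZ map_scalar_mx BM.
    have -> : diag_mx w = (f c ^+ 2) *: (eM *m eM) + (f (t ^+ 2))%:M.
      apply/matrixP => i j; rewrite mulmx_diag !mxE.
      case: eqVneq => [->|_]; last by rewrite !mulr0n mulr0 addr0.
      by rewrite !mulr1n rmorphD rmorphXn rmorphM fd exprMn expr2.
    rewrite mulmxDr mulmxDl; congr (_ + _).
      by rewrite -!scalemxAl -!scalemxAr -scalemxAl scalerA -expr2 !mulmxA mulmxK.
    by rewrite scalar_mxC -mulmxA mulVmx // mulmx1.
  have w0 i : w 0 i != 0.
    by rewrite mxE fmorph_eq0 gt_eqF // ltr_wpDl ?sqr_ge0 // exprn_gt0.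
  rewrite invmx_conj_diag // trP mxtrace_diag rmorph_sum.
  by apply: eq_bigr => i _; rewrite !mxE fmorphV.
Qed.

(** * Riemann sums *)

Section RiemannSums.
Variable R : realType.
Implicit Types (s t x y d : R) (N : nat).

(** [F] acts as an antiderivative of the decreasing [g]: on each cell the right-endpoint rule errs
    by at most [d (g k - g k.+1)], which telescopes. *)
Lemma riemann_sum_le (F g : nat -> R) d N : 0 <= d ->
  (forall k, g k.+1 * d <= F k.+1 - F k <= g k * d) -> g 0%N <= 1 -> 0 <= g N ->
  `|F N - F 0%N - d * \sum_(k < N) g k.+1| <= d.
Proof.
move=> d0 Fg g0 gN.
have /andP[H1 H2] : 0 <= F N - F 0%N - d * \sum_(k < N) g k.+1 <= (g 0%N - g N) * d.
  elim: N {gN} => [|N /andP[IH1 IH2]].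
    by rewrite big_ord0 mulr0 !subrr mul0r !lexx.
  rewrite big_ord_recr /=; have /andP[H1 H2] := Fg N.
  by apply/andP; split; lra.
by rewrite ger0_norm //; nra.
Qed.

Lemma atan_sub_le x y : x <= y -> 0 <= x ->
  (1 + y ^+ 2)^-1 * (y - x) <= atan y - atan x <= (1 + x ^+ 2)^-1 * (y - x).
Proof.
move=> xy x0; have dA z : z \in `]x, y[ -> is_derive z 1 (@atan R) (1 + z ^+ 2)^-1.
  by move=> _; exact: is_derive1_atan.
have [|c] := MVT_segment xy dA.
  by apply: continuous_subspaceT => z; exact: continuous_atan.
rewrite in_itv /= => /andP[xc cy] ->.
have p (z : R) : 0 < 1 + z ^+ 2 by rewrite ltr_pwDl ?sqr_ge0.
have yx : 0 <= y - x by rewrite subr_ge0.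
have c0 := le_trans x0 xc.
have y0 := le_trans c0 cy.
by apply/andP; split; apply: ler_wpM2r => //; rewrite lef_pV2 ?posrE ?p // lerD2l;
   apply: lerXn2r.
Qed.

Lemma pihalf_sub_atan_le y : 0 < y -> 0 <= pi / 2 - atan y <= y^-1.
Proof.
move=> y0; have a0 : 0 < atan y by rewrite -atan0 lt_atan.
have a1 := atan_ltpi2 y.
have sn0 : sin (atan y) != 0.
  apply: contraTneq y0 => E; rewrite -[y]atanK /tan E mul0r ltxx //.
have E : tan (pi / 2 - atan y) = y^-1.
  rewrite -opprB tanN /tan sinBpihalf cosBpihalf mulNr opprK.
  by rewrite -[y in RHS]atanK /tan invf_div.
have -> : pi / 2 - atan y = atan y^-1.
  rewrite -E tanK // in_itv /=; apply/andP; split; lra.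
have := @atan_sub_le 0 y^-1 _ (lexx _); rewrite invr_ge0 (ltW y0) => /(_ isT).
rewrite atan0 !subr0 expr0n addr0 invr1 mul1r => /andP[H ->]; rewrite andbT.
apply: le_trans H; rewrite mulr_ge0 ?invr_ge0 ?(ltW y0) //.
by rewrite addr_ge0 // sqr_ge0.
Qed.

(** [|x| atan (t / |x|)] is an antiderivative of [x^2 / (x^2 + t^2)] with limit [pi |x| / 2]. The
    mesh costs [d], the tail beyond [N d] costs [x^2 / (N d)]. *)
Lemma riemann_sum_norm x d N : 0 < d -> (0 < N)%N ->
  `|pi / 2 * `|x| - d * \sum_(k < N) x ^+ 2 / (x ^+ 2 + (k.+1%:R * d) ^+ 2)| <=
    d + x ^+ 2 / (N%:R * d).
Proof.
move=> d0 N0; have Nd : 0 < N%:R * d by rewrite mulr_gt0 ?ltr0n.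
have [->|xn0] := eqVneq x 0.
  rewrite normr0 expr0n /= big1 => [|k _]; last by rewrite mul0r.
  by rewrite !mulr0 subrr normr0 mul0r addr0 ltW.
have ax0 : 0 < `|x| by rewrite normr_gt0.
pose F k := `|x| * atan (k%:R * d / `|x|).
pose g k : R := (1 + (k%:R * d / `|x|) ^+ 2)^-1.
have gE k : x ^+ 2 / (x ^+ 2 + (k%:R * d) ^+ 2) = g k.
  rewrite /g expr_div_n real_normK ?num_real //; field.
  by rewrite xn0 gt_eqF // ltr_pwDl ?sqr_ge0 // exprn_even_gt0.
under eq_bigr => k _ do rewrite gE.
have H : `|F N - F 0%N - d * \sum_(k < N) g k.+1| <= d.
  apply: riemann_sum_le => [|k||]; first exact: ltW.
  - have := @atan_sub_le (k%:R * d / `|x|) (k.+1%:R * d / `|x|).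
    have -> : k.+1%:R * d / `|x| - k%:R * d / `|x| = d / `|x|.
      by rewrite -natr1; field; rewrite gt_eqF.
    have -> : g k * d = `|x| * ((1 + (k%:R * d / `|x|) ^+ 2)^-1 * (d / `|x|)).
      by rewrite mulrCA [`|x| * _]mulrC divfK ?gt_eqF.
    have -> : g k.+1 * d = `|x| * ((1 + (k.+1%:R * d / `|x|) ^+ 2)^-1 * (d / `|x|)).
      by rewrite mulrCA [`|x| * _]mulrC divfK ?gt_eqF.
    rewrite /F -mulrBr !ler_pM2l //; apply.
      by rewrite !ler_pM2r ?invr_gt0 // ler_nat.
    by rewrite divr_ge0 // mulr_ge0 // ltW.
  - by rewrite /g !mul0r expr0n addr0 invr1.
  - by rewrite /g invr_ge0 addr_ge0 ?sqr_ge0.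
have F0 : F 0%N = 0 by rewrite /F !mul0r atan0 mulr0.
have /andP[T1 T2] := @pihalf_sub_atan_le (N%:R * d / `|x|) (divr_gt0 Nd ax0).
have T : `|pi / 2 * `|x| - F N| <= x ^+ 2 / (N%:R * d).
  rewrite [pi / 2 * _]mulrC /F -mulrBr ger0_norm ?mulr_ge0 //.
  apply: le_trans (ler_wpM2l (ltW ax0) T2) _.
  by rewrite invf_div mulrA -expr2 real_normK ?num_real.
set S := d * _ in H *.
have -> : pi / 2 * `|x| - S = (F N - F 0%N - S) + (pi / 2 * `|x| - F N).
  by rewrite F0; ring.
by apply: le_trans (ler_normD _ _) _; apply: lerD.
Qed.

(** At [t = 0] the root is [h = s^(-1/2)], where the antiderivative is [- 4/3 sqrt s]. The tail is
    at most [4/3 h(N d)], and [h(t) <= 1 / t]. *)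
Lemma riemann_sum_semicircle s d N : 0 <= s <= 1 -> 0 < d -> (0 < N)%N ->
  `|4 / 3%:R * Num.sqrt s -
    d * \sum_(k < N) (1 - (k.+1%:R * d) * semicircle_im s (k.+1%:R * d))| <=
  d + 2 / (N%:R * d).
Proof.
move=> /andP[s0 s1] d0 N0; have Nd : 0 < N%:R * d by rewrite mulr_gt0 ?ltr0n.
pose h k := semicircle_im s (k%:R * d); pose g k := s * h k ^+ 2.
have gE k : 1 - (k.+1%:R * d) * semicircle_im s (k.+1%:R * d) = g k.+1.
  have kd : 0 < k.+1%:R * d by rewrite mulr_gt0 ?ltr0n.
  by rewrite -[X in X - _](semicircle_imE s0 (ltW kd) (ltr_wpDl s0 kd)) addrC addKr.
under eq_bigr => k _ do rewrite gE.
have [Es|sn0] := eqVneq s 0.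
  rewrite Es sqrtr0 mulr0 big1 => [|k _]; last by rewrite /g Es mul0r.
  by rewrite mulr0 subrr normr0 addr_ge0 ?divr_ge0 // ltW.
have s_gt0 : 0 < s by rewrite lt_def sn0.
have kd0 k : 0 <= k%:R * d by rewrite mulr_ge0 // ltW.
have st k : 0 < s + k%:R * d by rewrite ltr_wpDr.
have hgt0 k : 0 < h k := semicircle_im_gt0 s0 (kd0 k) (st k).
have hE k : (k%:R * d) * h k + s * h k ^+ 2 = 1 := semicircle_imE s0 (kd0 k) (st k).
have g01 k : 0 <= g k <= 1.
  rewrite -[X in _ && (_ <= X)](hE k) lerDr mulr_ge0 ?sqr_ge0 //=.
  by rewrite mulr_ge0 // ltW.
(* An antiderivative of [1 - t h t = s (h t)^2], where [t = 1 / h - s h]. *)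
pose F k := - (s * h k + s ^+ 2 * h k ^+ 3 / 3%:R).
have H : `|F N - F 0%N - d * \sum_(k < N) g k.+1| <= d.
  apply: riemann_sum_le => [|k||]; first exact: ltW; last 2 first.
  - by case/andP: (g01 0%N).
  - by case/andP: (g01 N).
  have := hE k; have := hE k.+1; have := hgt0 k; have := hgt0 k.+1.
  rewrite /g /F; set h2 := h k.+1; set h1 := h k => h20 h10 E2 E1.
  (* The relations [t = 1 / h - s h] at two neighbouring grid points, subtracted and cleared of
     denominators. *)
  have E : d * (h1 * h2) = (h1 - h2) * (1 + s * (h1 * h2)).
    have E1' : k%:R * d * h1 = 1 - s * h1 ^+ 2 by exact: (canRL (addrK _) E1).
    have E2' : k.+1%:R * d * h2 = 1 - s * h2 ^+ 2 by exact: (canRL (addrK _) E2).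
    transitivity ((k.+1%:R * d * h2) * h1 - (k%:R * d * h1) * h2).
      by rewrite -natr1; ring.
    by rewrite E2' E1'; ring.
  have hh : 0 < h1 * h2 by rewrite mulr_gt0.
  have h12 : 0 < h1 - h2.
    have P : 0 < 1 + s * (h1 * h2) by rewrite ltr_wpDr // mulr_ge0 // ltW.
    by rewrite -(pmulr_lgt0 _ P) -E mulr_gt0.
  have -> : - (s * h2 + s ^+ 2 * h2 ^+ 3 / 3%:R) - - (s * h1 + s ^+ 2 * h1 ^+ 3 / 3%:R) =
     s * (h1 - h2) * (1 + s * (h1 ^+ 2 + h1 * h2 + h2 ^+ 2) / 3%:R) by field.
  (* Multiplying by [h1 h2] eliminates [d] through [E]; in terms of [u = h1 - h2 > 0] both
     inequalities become polynomials with nonnegative terms. *)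
  rewrite -(ler_pM2r hh) -[X in _ && X](ler_pM2r hh).
  have -> : s * h2 ^+ 2 * d * (h1 * h2) = s * (h1 - h2) * (h2 ^+ 2 * (1 + s * (h1 * h2))).
    by rewrite -mulrA E; ring.
  have -> : s * h1 ^+ 2 * d * (h1 * h2) = s * (h1 - h2) * (h1 ^+ 2 * (1 + s * (h1 * h2))).
    by rewrite -mulrA E; ring.
  rewrite -[_ * (1 + s * _ / 3%:R) * _]mulrA !ler_pM2l ?mulr_gt0 //.
  rewrite (_ : h1 = h2 + (h1 - h2)); last by ring.
  move: (h1 - h2) h12 => u u0; apply/andP; split; rewrite -subr_ge0.
    rewrite [leRHS](_ : _ = u * h2 + s * (h2 + u) * h2 * (3%:R * u * h2 + u ^+ 2) / 3%:R); last by field.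
    by do ?[exact: ltW | apply: addr_ge0 | apply: mulr_ge0 | rewrite invr_ge0 ler0n | exact: ler0n | exact: sqr_ge0].
  rewrite [leRHS](_ : _ = u * (h2 + u) + s * (h2 + u) * h2 * (3%:R * u * h2 + 2 * u ^+ 2) / 3%:R); last by field.
  by do ?[exact: ltW | apply: addr_ge0 | apply: mulr_ge0 | rewrite invr_ge0 ler0n | exact: ler0n | exact: sqr_ge0].
have F0 : F 0%N = - (4 / 3%:R * Num.sqrt s).
  have r0 : 0 < Num.sqrt s by rewrite sqrtr_gt0.
  have -> : F 0%N = - (h 0%N * s + (s * h 0%N ^+ 2) * (h 0%N * s) / 3%:R) by rewrite /F; ring.
  have sh : s * h 0%N ^+ 2 = 1 by rewrite -(hE 0%N) !mul0r add0r.
  have -> : h 0%N * s = Num.sqrt s.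
    have E : (h 0%N * s) ^+ 2 = s by transitivity (s * h 0%N ^+ 2 * s); [ring|rewrite sh mul1r].
    by rewrite -[in RHS]E sqrtr_sqr ger0_norm // mulr_ge0 // ltW.
  by rewrite sh; field.
have T : `|F N| <= 2 / (N%:R * d).
  have /andP[_ gN] := g01 N; have hN := hgt0 N; have := hE N.
  have shh : 0 <= s * h N ^+ 2 by rewrite mulr_ge0 ?sqr_ge0.
  move=> hEN; have hNd : h N <= (N%:R * d)^-1.
    by rewrite -[leRHS]mul1r ler_pdivlMr // mulrC -[leRHS]hEN lerDl.
  have hs : s * h N <= h N by rewrite -[leRHS]mul1r ler_wpM2r // ltW.
  have hs0 : 0 <= s * h N by rewrite mulr_ge0 // ltW.
  have -> : F N = - (s * h N + g N * (s * h N) / 3%:R) by rewrite /F /g; ring.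
  have gs : 0 <= g N * (s * h N) <= s * h N.
    by rewrite mulr_ge0 //= -[leRHS]mul1r ler_wpM2r.
  by rewrite normrN ger0_norm; lra.
set S := d * _ in H *.
have -> : 4 / 3%:R * Num.sqrt s - S = (F N - F 0%N - S) - F N by rewrite F0; ring.
by apply: le_trans (ler_normB _ _) _; apply: lerD.
Qed.

End RiemannSums.

(** * Energy of the random multipartite graph *)

Section EnergyApproximation.
Variables (R : realType) (p : R) (n : nat) (G : graph n) (d : R) (N : nat).
Hypotheses (n_gt0 : (0 < n)%N) (d_gt0 : 0 < d) (N_gt0 : (0 < N)%N).

Let kappa : R := (Num.sqrt n%:R)^-1.
Let s := p * (1 - p).
Let t (k : nat) : R := k.+1%:R * d.
Let b k := \tr (resolvent_im (kappa *: adjmx R G) (t k)) / n%:R.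

Let n0 : (0 : R) < n%:R. Proof. by rewrite ltr0n. Qed.

Let kappa2 : kappa ^+ 2 = n%:R^-1.
Proof. by rewrite exprVn sqr_sqrtr. Qed.

(** On the spectrum, [1 - t b] is the mean of [y^2 / (y^2 + t^2)] over the scaled eigenvalues [y].
    The tails average to at most [1 / (N d)] since [tr adj^2 <= n^2], so even eigenvalues of order
    [n] do no harm. *)
Lemma energy_riemann_sum :
  `|pi / 2 * (kappa / n%:R * energy R G) - d * \sum_(k < N) (1 - t k * b k)| <=
  d + 1 / (N%:R * d).
Proof.
have [x [sumF tr2 trinv]] := symmetric_spectrum (tr_adjmx R G).
have k0 : 0 < kappa by rewrite invr_gt0 sqrtr_gt0.
have t0 k : 0 < t k by rewrite mulr_gt0 ?ltr0n.
have x2 : \sum_i x i ^+ 2 <= n%:R ^+ 2.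
  rewrite -tr2 expr2 [leRHS]mulr_natr -[X in _ *+ X]card_ord -sumr_const.
  apply: ler_sum => i _.
  rewrite mxE -[n in leRHS]card_ord -sumr_const; apply: ler_sum => j _.
  by rewrite !mxE -natrM lern1; do 2!case: (_ && _).
have -> : d * \sum_(k < N) (1 - t k * b k) =
    n%:R^-1 * \sum_i d * \sum_(k < N) (kappa * x i) ^+ 2 / ((kappa * x i) ^+ 2 + t k ^+ 2).
  rewrite -big_distrr /= [RHS]mulrCA; congr (_ * _).
  rewrite exchange_big /= big_distrr /=; apply: eq_bigr => k _.
  rewrite /b /resolvent_im mxtraceZ trinv //.
  have -> : \sum_i (kappa * x i) ^+ 2 / ((kappa * x i) ^+ 2 + t k ^+ 2) =
     n%:R - t k ^+ 2 * \sum_i ((kappa * x i) ^+ 2 + t k ^+ 2)^-1.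
    have -> : n%:R = \sum_(i < n) (1 : R) by rewrite sumr_const card_ord.
    rewrite big_distrr -sumrB /=; apply: eq_bigr => i _.
    have D0 : (kappa * x i) ^+ 2 + t k ^+ 2 != 0.
      by rewrite gt_eqF // ltr_wpDl ?sqr_ge0 // exprn_gt0.
    by field.
  by field; rewrite gt_eqF.
have -> : pi / 2 * (kappa / n%:R * energy R G) = n%:R^-1 * \sum_i (pi / 2 * `|kappa * x i|).
  rewrite /energy sumF -mulr_sumr.
  have -> : \sum_i `|kappa * x i| = kappa * \sum_i `|x i|.
    by rewrite mulr_sumr; apply: eq_bigr => i _; rewrite normrM gtr0_norm.
  by ring.
rewrite -mulrBr -sumrB normrM gtr0_norm ?invr_gt0 // mulrC ler_pdivrMr //.
apply: le_trans (ler_norm_sum _ _ _) _.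
apply: (@le_trans _ _ (\sum_i (d + (kappa * x i) ^+ 2 / (N%:R * d)))).
  by apply: ler_sum => i _; apply: riemann_sum_norm.
rewrite big_split /= sumr_const card_ord -mulr_suml mulrDl -[d *+ n]mulr_natr lerD2l.
under eq_bigr => i _ do rewrite exprMn.
rewrite -mulr_sumr kappa2 mul1r mulrC ler_wpM2l ?invr_ge0 ?mulr_ge0 ?(ltW d_gt0) //.
by rewrite mulrC ler_pdivrMr // -expr2.
Qed.

(** Deterministic for each graph: two mesh errors give [2 d], the two tails give [1 + 2 = 3] over
    [N d]. Only the last sum is left to probability. *)
Lemma energy_semicircle : 0 <= s <= 1 ->
  `|pi / 2 * (kappa / n%:R * energy R G) - 4 / 3%:R * Num.sqrt s| <=
  2 * d + 3%:R / (N%:R * d) +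
  d * \sum_(k < N) t k * `|b k - semicircle_im s (t k)|.
Proof.
move=> s01; have H1 := energy_riemann_sum.
have H2 := riemann_sum_semicircle s01 d_gt0 N_gt0.
set E := pi / 2 * _ in H1 *; set S := d * _ in H1; set T := d * _ in H2.
have H3 : `|S - T| <= d * \sum_(k < N) t k * `|b k - semicircle_im s (t k)|.
  rewrite -mulrBr normrM gtr0_norm // ler_pM2l // -sumrB.
  apply: le_trans (ler_norm_sum _ _ _) _; apply: ler_sum => k _.
  have t0 : 0 <= t k by rewrite mulr_ge0 // ltW.
  have -> : 1 - t k * b k - (1 - k.+1%:R * d * semicircle_im s (k.+1%:R * d)) =
      - (t k * (b k - semicircle_im s (t k))) by rewrite /t; ring.
  by rewrite normrN normrM (ger0_norm t0).
have -> : E - 4 / 3%:R * Num.sqrt s = (E - S) + (S - T) - (4 / 3%:R * Num.sqrt s - T) by ring.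
apply: le_trans (ler_normB _ _) _; have := ler_normD (E - S) (S - T).
by rewrite mulrDl in H2 *; lra.
Qed.

End EnergyApproximation.

(** The first term pays for the uncentering, the second is the standard deviation, the third the
    bias from the self-consistent equations. *)
Definition transform_error (R : realType) (t kappa mu : R) : R :=
  2 * kappa / t ^+ 2 + (2 * kappa / t ^+ 2 +
  (2 * (pair_error t * (kappa + mu)) + 2 * (2 * kappa / t ^+ 2) ^+ 2) *
     (1 + t ^- 2) / t).

Lemma multipartite_prE (R : realType) (p : R) (n m : nat) (V : 'I_m -> {set 'I_n})
    (E : set (graph n)) :
  multipartite_pr p V E =
  expect p (complete_multipartite V) (fun G => (G \in E)%:R).
Proof.
rewrite /multipartite_pr /expect big_mkcondr /=; apply: eq_bigr => G _.
by case: (G \in E); rewrite ?mulr1 ?mulr0.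
Qed.

Section Markov.
Variables (R : realType) (p : R) (n m : nat) (V : 'I_m -> {set 'I_n}) (mu : R).
Hypotheses (p01 : 0 <= p <= 1) (n_gt0 : (0 < n)%N) (partV : vertex_partition V).
Hypothesis cardV : forall k, #|V k|%:R <= n%:R * mu.

Let K := complete_multipartite V.
Let kappa : R := (Num.sqrt n%:R)^-1.

Lemma expect_uncentered_dist (t : R) : 0 < t ->
  expect p K (fun G => `|\tr (resolvent_im (kappa *: adjmx R G) t) / n%:R -
                         semicircle_im (p * (1 - p)) t|) <=
  transform_error t kappa mu.
Proof.
move=> t0; have H := expect_semicircle_dist p01 n_gt0 partV cardV t0.
apply: le_trans (lerD (lexx _) H); rewrite -[X in _ <= X + _](expect_cst p K) -expectD.
apply: ler_expect => // G _.
have := trace_resolvent_uncentered p01 n_gt0 partV t0 G; rewrite -/kappa -/K.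
set x := _ / _; set y := _ / _; set z := semicircle_im _ _ => xy.
by rewrite -(subrKA y); apply: le_trans (ler_normD _ _) _; rewrite lerD2r.
Qed.

(** Half of the allowance [2 eps] covers mesh and tail; the other half is exceeded only where the
    weighted grid sum reaches [eps], an event whose probability Markov bounds. *)
Lemma multipartite_pr_ge (d eps : R) (N : nat) (E : set (graph n)) :
  0 < d -> (0 < N)%N -> 2 * d + 3%:R / (N%:R * d) <= eps ->
  (forall G : graph n,
     `|pi / 2 * (kappa / n%:R * energy R G) -
       4 / 3%:R * Num.sqrt (p * (1 - p))| <= 2 * eps -> E G) ->
  1 - d * (\sum_(k < N) (k.+1%:R * d) * transform_error (k.+1%:R * d) kappa mu) / eps <=
  multipartite_pr p V E.
Proof.
move=> d0 N0 small HE.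
have Nd : 0 < N%:R * d by rewrite mulr_gt0 ?ltr0n.
have eps0 : 0 < eps.
  by apply: lt_le_trans small; apply: addr_gt0; [exact: mulr_gt0|exact: divr_gt0].
have t0 k : 0 < k.+1%:R * d by rewrite mulr_gt0 ?ltr0n.
pose f (G : graph n) := d * \sum_(k < N) (k.+1%:R * d) *
   `|\tr (resolvent_im (kappa *: adjmx R G) (k.+1%:R * d)) / n%:R -
     semicircle_im (p * (1 - p)) (k.+1%:R * d)|.
have f0 G : 0 <= f G.
  apply: mulr_ge0; [exact: ltW|apply: sumr_ge0 => k _].
  by apply: mulr_ge0; [exact: ltW (t0 k)|exact: normr_ge0].
rewrite multipartite_prE.
apply: (@le_trans _ _ (1 - expect p K f / eps)).
  rewrite lerD2l lerN2 ler_pM2r ?invr_gt0 // expectZ ler_pM2l // expect_sum.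
  apply: ler_sum => k _; rewrite expectZ ler_pM2l //.
  exact: expect_uncentered_dist.
apply: markov_expect => // G _; apply: contraNle => fG.
rewrite inE; apply: HE.
have s01 : 0 <= p * (1 - p) <= 1 by move: p01 => /andP[q0 q1]; apply/andP; split; nra.
apply: le_trans (energy_semicircle G n_gt0 d0 N0 s01) _; rewrite -/kappa -/(f G).
by rewrite [2 * eps]mulrDl mul1r lerD // ltW.
Qed.

End Markov.

Lemma cvg_invr_sqrt (R : realType) : (fun n : nat => (Num.sqrt n%:R)^-1) @ \oo --> (0 : R).
Proof.
rewrite -cvg_shiftS.
have E : (fun n : nat => (Num.sqrt n.+1%:R)^-1 : R) = Num.sqrt \o (@harmonic R).
  by apply/funext => n; rewrite /= /harmonic sqrtrV.
have : (Num.sqrt \o @harmonic R) @ \oo --> Num.sqrt (0 : R).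
  by apply: continuous_cvg; [exact: sqrt_continuous | exact: cvg_harmonic].
by rewrite sqrtr0 -E.
Qed.

(** For fixed [t] the error is a polynomial in [kappa] and [mu] without constant term; [c'], [c] and
    [c''] are its coefficients. *)
Lemma cvg_transform_error (R : realType) (t : R) (kappa mu : nat -> R) :
  kappa @ \oo --> (0 : R) -> mu @ \oo --> (0 : R) ->
  (fun n => transform_error t (kappa n) (mu n)) @ \oo --> (0 : R).
Proof.
move=> ck cm; pose c := 2 * pair_error t * (1 + t ^- 2) / t.
pose c' := 4 * t ^- 2 + c; pose c'' := 8%:R * t ^- 4 * (1 + t ^- 2) / t.
have -> : (fun n => transform_error t (kappa n) (mu n)) =
    (fun n => kappa n * c' + mu n * c + kappa n * kappa n * c'').
  by apply/funext => n; rewrite /transform_error /c' /c'' /c -!exprVn; ring.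
have -> : (0 : R) = 0 * c' + 0 * c + 0 * 0 * c'' by rewrite !mul0r !addr0.
by apply: cvgD; [apply: cvgD|]; apply: cvgM; do ?[exact: cvg_cst | apply: cvgM].
Qed.

Theorem mainTheorem4 (R : realType) (p : R) (hp : 0 <= p <= 1)
    (m : nat -> nat)
    (V : forall n : nat, 'I_(m n) -> {set 'I_n})
    (nu : forall n : nat, 'I_(m n) -> R)
    (hm : forall n : nat, (2 <= n)%N -> (2 <= m n)%N)
    (hV : forall n : nat, (2 <= n)%N -> vertex_partition (V n))
    (hnu : forall n : nat, (2 <= n)%N ->
       forall i : 'I_(m n), #|V n i|%:R = n%:R * nu n i)
    (hmax : (fun n : nat => \big[Num.max/0]_(i < m n) nu n i) @ \oo --> (0 : R)) :
  forall eps : R, 0 < eps ->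
    (fun n : nat => multipartite_pr p (V n)
       [set G : graph n | exists2 e : R, `|e| <= eps &
          energy R G =
          n%:R `^ (3%:R / 2%:R) *
            (8%:R / (3%:R * pi) * Num.sqrt (p * (1 - p)) + e)])
    @ \oo --> (1 : R).
Proof.
move=> eps eps0.
pose mu n : R := \big[Num.max/0]_(i < m n) nu n i.
pose kappa n : R := (Num.sqrt n%:R)^-1.
(* Chosen so that [2 eps' = pi / 2 eps], because the estimate controls the energy multiplied by
   [pi / 2]. *)
pose eps' : R := pi / 4 * eps.
have pi0 : (0 : R) < pi := pi_gt0 R.
have eps'0 : 0 < eps' by rewrite mulr_gt0 // divr_gt0.
(* Mesh and tail take half of [eps'] each: [2 d = eps' / 2] and [3 / (N d) <= eps' / 2]. Neither [d]
   nor [N] depends on [n], so [err] is a finite sum of null sequences. *)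
pose d := eps' / 4.
have d0 : 0 < d by rewrite divr_gt0.
pose N := (Num.trunc (6%:R / d / eps')).+1.
have N0 : (0 < N)%N by [].
have small : 2 * d + 3%:R / (N%:R * d) <= eps'.
  have : 6%:R / d / eps' <= N%:R by apply: ltW; exact: truncnS_gt.
  rewrite ler_pdivrMr // ler_pdivrMr // => H.
  have : 3%:R / (N%:R * d) <= eps' / 2.
    rewrite ler_pdivrMr ?mulr_gt0 ?ltr0n //.
    have -> : eps' / 2 * (N%:R * d) = N%:R * eps' * d / 2 by ring.
    by move: (_ * d) H => x; lra.
  have -> : 2 * d = eps' / 2 by rewrite /d; field.
  lra.
pose err n := d * (\sum_(k < N) (k.+1%:R * d) *
  transform_error (k.+1%:R * d) (kappa n) (mu n)) / eps'.
have err0 : (fun n => 1 - err n) @ \oo --> (1 : R).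
  suff : (fun n => 1 - err n) @ \oo -->
      (1 - d * (\sum_(k < N) (k.+1%:R * d) * 0) / eps' : R).
    by rewrite big1 ?mulr0 ?mul0r ?subr0 // => k _; rewrite mulr0.
  apply: cvgB; first exact: cvg_cst.
  apply: cvgM; last exact: cvg_cst.
  apply: cvgM; first exact: cvg_cst.
  pose F (k : 'I_N) n := (k.+1%:R * d) * transform_error (k.+1%:R * d) (kappa n) (mu n).
  apply: (@cvg_big R 'I_N +%R 0 xpredT _ nat \oo _ F) => [|k _]; first exact: add_continuous.
  apply: cvgM; first exact: cvg_cst.
  by apply: cvg_transform_error; [exact: cvg_invr_sqrt | exact: hmax].
apply: (@squeeze_cvgr nat \oo _ R (fun n => 1 - err n) (fun=> 1) _ _ 1 err0 (cvg_cst _)).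
near=> n.
have n2 : (2 <= n)%N by near: n; exact: nbhs_infty_ge.
have n_gt0 : (0 < n)%N by apply: leq_trans n2.
have n0 : (0 : R) < n%:R by rewrite ltr0n.
have sn0 : (0 : R) < Num.sqrt n%:R by rewrite sqrtr_gt0.
apply/andP; split; last first.
  rewrite multipartite_prE -[leRHS](expect_cst p (complete_multipartite (V n))).
  by apply: ler_expect => // G _; rewrite lern1 leq_b1.
have cardV k : #|V n k|%:R <= n%:R * mu n.
  by rewrite (hnu n n2) ler_pM2l //; exact: le_bigmax.
apply: (multipartite_pr_ge hp n_gt0 (hV n n2) cardV d0 N0 small) => G.
set S := Num.sqrt (p * (1 - p)) => H.
exists (kappa n / n%:R * energy R G - 8%:R / (3%:R * pi) * S).
  (* Here [pi / 2] times [8 / (3 pi)] becomes [4 / 3], with a variable [q] in place of [pi]. *)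
  have E (q x : R) : 0 < q ->
      q / 2 * (x - 8%:R / (3%:R * q) * S) = q / 2 * x - 4 / 3%:R * S.
    by move=> q0; field; rewrite gt_eqF.
  move: H; rewrite -(E _ _ pi0) normrM gtr0_norm ?divr_gt0 //.
  have -> : 2 * eps' = pi / 2 * eps by rewrite /eps'; field.
  by rewrite ler_pM2l ?divr_gt0.
rewrite addrC subrK.
have -> : (n%:R : R) `^ (3%:R / 2) = n%:R * Num.sqrt n%:R.
  have -> : 3%:R / 2 = 1 + 2^-1 :> R by field.
  by rewrite powRD ?(gt_eqF n0) ?implybT // powRr1 ?ltW // powR12_sqrt // ltW.
by rewrite /kappa; field; rewrite !gt_eqF.
Unshelve. all: by end_near.
Qed.
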